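(* Let $V$ be the component of the free partially alternating ternary algebra over $\mathbb{Q}$ on $\{a,b,c,d,e\}$ spanned by the degree 7 monomials whose variables are a permutation of $a,a,b,b,c,d,e$, and let $N\subseteq V$ be the subspace of elements $f$ such that $f\equiv 0$ is satisfied by the partially alternating ternary sum. Then there are two identities for the partition $22111$, both with 60 terms; that is, $N$ is two-dimensional with basis $I_{22111}^{(1)}, I_{22111}^{(2)}$, each having 60 terms, where $$I_{22111}^{(1)}=\frac14\sum_{\sigma\in S_5}\epsilon(\sigma)[[[a\,a^\sigma b^\sigma]\,b\,c^\sigma]\,d^\sigma e^\sigma]-\frac1{12}\sum_{\sigma\in S_5}\epsilon(\sigma)[[a\,[a^\sigma b^\sigma c^\sigma]\,b]\,d^\sigma e^\sigma]$$ $$\qquad-\frac1{12}\sum_{\sigma\in S_5}\epsilon(\sigma)[[a\,a^\sigma b^\sigma]\,[c^\sigma d^\sigma e^\sigma]\,b]-\frac16\sum_{\sigma\in S_5}\epsilon(\sigma)[a\,[[a^\sigma b^\sigma c^\sigma]\,b\,d^\sigma]\,e^\sigma],$$ and $I_{22111}^{(2)}$ is obtained from $I_{22111}^{(1)}$ by interchanging $a$ and $b$. Here $S_5$ acts on $\{a,b,c,d,e\}$, the symbols $a,b$ without superscript are not permuted by $\sigma$, and $[xyz]$ denotes the ternary product.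
   Context: The base field is $\mathbb{Q}$. An (associative) dialgebra is a vector space $A$ with two bilinear products $\dashv,\vdash$ satisfying $(a\dashv b)\dashv c=a\dashv(b\dashv c)$, $(a\vdash b)\vdash c=a\vdash(b\vdash c)$, $(a\vdash b)\dashv c=a\vdash(b\dashv c)$, $(a\dashv b)\vdash c=(a\vdash b)\vdash c$, $a\dashv(b\dashv c)=a\dashv(b\vdash c)$. The partially alternating ternary sum (PATS) is the trilinear operation on a dialgebra $$[a,b,c]=a\dashv b\dashv c-a\dashv c\dashv b-b\vdash a\dashv c+c\vdash a\dashv b+b\vdash c\vdash a-c\vdash b\vdash a .$$ A ternary algebra is a vector space with a trilinear product. A partially alternating ternary algebra (PATA) is a ternary algebra satisfying $[x,y,z]+[x,z,y]=0$ and $[v,[w,x,y],z]+[v,[x,w,y],z]=0$; every dialgebra is a PATA under the PATS. The free PATA is the quotient of the free ternary algebra by all consequences of these two identities. For an element $f$ of the free PATA, $f\equiv0$ is satisfied by the PATS if $f$ vanishes for all values of the variables in every dialgebra, with the ternary product interpreted as the PATS. A basis of the degree 7 part of the free PATA (with totally ordered generators) is given by the straightened monomials (1) $[[[x_1x_2x_3]x_4x_5]x_6x_7]$ with $x_2<x_3$, $x_4<x_5$, $x_6<x_7$; (2) $[[x_1[x_2x_3x_4]x_5]x_6x_7]$ with $x_2<x_3<x_4$, $x_6<x_7$; (3) $[[x_1x_2x_3][x_4x_5x_6]x_7]$ with $x_2<x_3$, $x_4<x_5<x_6$; (4) $[x_1[[x_2x_3x_4]x_5x_6]x_7]$ with $x_2<x_3<x_4$,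 $x_5<x_6$; (5) $[x_1[x_2x_3x_4][x_5x_6x_7]]$ with $x_2<x_3<x_4$, $x_5<x_6<x_7$ and $(x_2,x_3,x_4)<(x_5,x_6,x_7)$ lexicographically. The number of terms of an element is the number of straightened monomials with nonzero coefficient when it is written in this basis. Here $a<b<\cdots$, $\epsilon(\sigma)$ is the sign of $\sigma$, and $x^\sigma$ is the image of $x$ under $\sigma$. *)

(* Defs.v *)
From HB Require Import structures.
From mathcomp Require Import all_boot all_order all_algebra all_fingroup.
From mathcomp Require Import generic_quotient ring_quotient finmap monalg.
From mathcomp Require Import boolp.

Set Implicit Arguments.
Unset Strict Implicit.
Unset Printing Implicit Defensive.

Import GRing.Theory.

Local Open Scope ring_scope.
Local Open Scope quotient_scope.

HB.mixin Record Lmodule_isDialgebra A of GRing.Lmodule rat A := {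
  dleft : A -> A -> A;
  dright : A -> A -> A;
  dleft_linearl : forall y, linear (dleft^~ y);
  dleft_linearr : forall x, linear (dleft x);
  dright_linearl : forall y, linear (dright^~ y);
  dright_linearr : forall x, linear (dright x);
  dleftA : forall x y z, dleft (dleft x y) z = dleft x (dleft y z);
  drightA : forall x y z, dright (dright x y) z = dright x (dright y z);
  drightleftA : forall x y z, dleft (dright x y) z = dright x (dleft y z);
  dbar_left : forall x y z, dright (dleft x y) z = dright (dright x y) z;
  dbar_right : forall x y z, dleft x (dleft y z) = dleft x (dright y z)
}.

#[short(type="dialgebraType")]
HB.structure Definition Dialgebra :=
  {A of Lmodule_isDialgebra A & GRing.Lmodule rat A}.

Reserved Notation "x ⊣ y" (at level 40, left associativity).
Reserved Notation "x ⊢ y" (at level 40, left associativity).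
Notation "x ⊣ y" := (dleft x y) : ring_scope.
Notation "x ⊢ y" := (dright x y) : ring_scope.

HB.mixin Record Lmodule_isTernary A of GRing.Lmodule rat A := {
  tprod : A -> A -> A -> A;
  tprod_linear1 : forall y z, linear (fun x => tprod x y z);
  tprod_linear2 : forall x z, linear (fun y => tprod x y z);
  tprod_linear3 : forall x y, linear (tprod x y)
}.

#[short(type="ternaryType")]
HB.structure Definition Ternary :=
  {A of Lmodule_isTernary A & GRing.Lmodule rat A}.

Notation "[tp x , y , z ]" := (tprod x y z)
  (format "[tp  x ,  y ,  z ]") : ring_scope.

HB.mixin Record Ternary_isPATA A of Ternary A := {
  pata_alt23 : forall x y z : A, [tp x, y, z] + [tp x, z, y] = 0;
  pata_alt_inner : forall v w x y z : A,
    [tp v, [tp w, x, y], z] + [tp v, [tp x, w, y], z] = 0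
}.

#[short(type="pataType")]
HB.structure Definition PATA := {A of Ternary_isPATA A & Ternary A}.

Section Trilinear.
Variable A : ternaryType.
Implicit Types x y z : A.

Lemma tprodD1 x x' y z : [tp x + x', y, z] = [tp x, y, z] + [tp x', y, z].
Proof. by have := tprod_linear1 y z 1 x x'; rewrite !scale1r. Qed.
Lemma tprodD2 x y y' z : [tp x, y + y', z] = [tp x, y, z] + [tp x, y', z].
Proof. by have := tprod_linear2 x z 1 y y'; rewrite !scale1r. Qed.
Lemma tprodD3 x y z z' : [tp x, y, z + z'] = [tp x, y, z] + [tp x, y, z'].
Proof. by have := tprod_linear3 x y 1 z z'; rewrite !scale1r. Qed.
Lemma tprod0_1 y z : [tp 0, y, z] = 0 :> A.
Proof. by apply: (addIr [tp 0, y, z]); rewrite -tprodD1 !add0r. Qed.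
Lemma tprod0_2 x z : [tp x, 0, z] = 0 :> A.
Proof. by apply: (addIr [tp x, 0, z]); rewrite -tprodD2 !add0r. Qed.
Lemma tprod0_3 x y : [tp x, y, 0] = 0 :> A.
Proof. by apply: (addIr [tp x, y, 0]); rewrite -tprodD3 !add0r. Qed.
Lemma tprodZ1 c x y z : [tp c *: x, y, z] = c *: [tp x, y, z].
Proof. by have := tprod_linear1 y z c x 0; rewrite tprod0_1 !addr0. Qed.
Lemma tprodZ2 c x y z : [tp x, c *: y, z] = c *: [tp x, y, z].
Proof. by have := tprod_linear2 x z c y 0; rewrite tprod0_2 !addr0. Qed.
Lemma tprodZ3 c x y z : [tp x, y, c *: z] = c *: [tp x, y, z].
Proof. by have := tprod_linear3 x y c z 0; rewrite tprod0_3 !addr0. Qed.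
Lemma tprodN1 x y z : [tp - x, y, z] = - [tp x, y, z].
Proof. by rewrite -scaleN1r tprodZ1 scaleN1r. Qed.
Lemma tprodN2 x y z : [tp x, - y, z] = - [tp x, y, z].
Proof. by rewrite -scaleN1r tprodZ2 scaleN1r. Qed.
Lemma tprodN3 x y z : [tp x, y, - z] = - [tp x, y, z].
Proof. by rewrite -scaleN1r tprodZ3 scaleN1r. Qed.
End Trilinear.

Section DialgebraTheory.
Variable D : dialgebraType.
Implicit Types x y z : D.

Lemma dleftDl x x' y : (x + x') ⊣ y = (x ⊣ y) + (x' ⊣ y).
Proof. by have := dleft_linearl y 1 x x'; rewrite !scale1r. Qed.
Lemma dleftDr x y y' : x ⊣ (y + y') = (x ⊣ y) + (x ⊣ y').
Proof. by have := dleft_linearr x 1 y y'; rewrite !scale1r. Qed.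
Lemma drightDl x x' y : (x + x') ⊢ y = (x ⊢ y) + (x' ⊢ y).
Proof. by have := dright_linearl y 1 x x'; rewrite !scale1r. Qed.
Lemma drightDr x y y' : x ⊢ (y + y') = (x ⊢ y) + (x ⊢ y').
Proof. by have := dright_linearr x 1 y y'; rewrite !scale1r. Qed.
Lemma dleft0l y : 0 ⊣ y = 0 :> D.
Proof. by apply: (addIr (0 ⊣ y)); rewrite -dleftDl !add0r. Qed.
Lemma dleft0r x : x ⊣ 0 = 0 :> D.
Proof. by apply: (addIr (x ⊣ 0)); rewrite -dleftDr !add0r. Qed.
Lemma dright0l y : 0 ⊢ y = 0 :> D.
Proof. by apply: (addIr (0 ⊢ y)); rewrite -drightDl !add0r. Qed.
Lemma dright0r x : x ⊢ 0 = 0 :> D.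
Proof. by apply: (addIr (x ⊢ 0)); rewrite -drightDr !add0r. Qed.
Lemma dleftZl c x y : (c *: x) ⊣ y = c *: (x ⊣ y).
Proof. by have := dleft_linearl y c x 0; rewrite dleft0l !addr0. Qed.
Lemma dleftZr c x y : x ⊣ (c *: y) = c *: (x ⊣ y).
Proof. by have := dleft_linearr x c y 0; rewrite dleft0r !addr0. Qed.
Lemma drightZl c x y : (c *: x) ⊢ y = c *: (x ⊢ y).
Proof. by have := dright_linearl y c x 0; rewrite dright0l !addr0. Qed.
Lemma drightZr c x y : x ⊢ (c *: y) = c *: (x ⊢ y).
Proof. by have := dright_linearr x c y 0; rewrite dright0r !addr0. Qed.
Lemma dleftNl x y : (- x) ⊣ y = - (x ⊣ y).
Proof. by rewrite -scaleN1r dleftZl scaleN1r. Qed.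
Lemma dleftNr x y : x ⊣ (- y) = - (x ⊣ y).
Proof. by rewrite -scaleN1r dleftZr scaleN1r. Qed.
Lemma drightNl x y : (- x) ⊢ y = - (x ⊢ y).
Proof. by rewrite -scaleN1r drightZl scaleN1r. Qed.
Lemma drightNr x y : x ⊢ (- y) = - (x ⊢ y).
Proof. by rewrite -scaleN1r drightZr scaleN1r. Qed.
End DialgebraTheory.

(* The partially alternating ternary sum.  Unparenthesized products are read
   with left associativity; the dialgebra axioms make this irrelevant. *)
Definition pats (D : dialgebraType) (a b c : D) : D :=
  (a ⊣ b ⊣ c) - (a ⊣ c ⊣ b) - (b ⊢ a ⊣ c) + (c ⊢ a ⊣ b)
  + (b ⊢ c ⊢ a) - (c ⊢ b ⊢ a).

Section PATSisPATA.
Variable D : dialgebraType.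
Implicit Types a b c v w x y z : D.

Let dE := (@dleftDl D, @dleftDr D, @drightDl D, @drightDr D, @dleftNl D,
  @dleftNr D, @drightNl D, @drightNr D, @dleftZl D, @dleftZr D, @drightZl D,
  @drightZr D).

Let addNKr' (x y : D) : - x + (x + y) = y. Proof. exact: addKr. Qed.
Let addKr' (x y : D) : x + (- x + y) = y. Proof. by rewrite addrA subrr add0r. Qed.

Let eq_sub0 (x y : D) : x - y + 0 = 0 -> x = y.
Proof. by rewrite addr0 => /eqP; rewrite subr_eq0 => /eqP. Qed.

Ltac bring_opp h :=
  first [rewrite (addKr' h) | rewrite (addrCA _ (- h)); bring_opp h].
Ltac bring h :=
  first [rewrite (addNKr' h) | rewrite (addrCA _ h); bring h].
Ltac cancel_head :=
  match goal with
  | |- - ?h + _ = 0 => bring h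
  | |- ?h + _ = 0 => bring_opp h
  end.
Ltac zcancel :=
  rewrite ?scalerDr ?scalerN ?opprD ?opprK; apply: eq_sub0;
  rewrite ?opprD ?opprK -?addrA; repeat cancel_head; rewrite ?oppr0 ?addr0; try done.

Lemma pats_linear1 y z : linear (fun x => pats x y z).
Proof. move=> c u v; rewrite /pats !dE. zcancel. Qed.

Lemma pats_linear2 x z : linear (fun y => pats x y z).
Proof. by move=> c u v; rewrite /pats !dE; zcancel. Qed.

Lemma pats_linear3 x y : linear (pats x y).
Proof. by move=> c u v; rewrite /pats !dE; zcancel. Qed.

Lemma pats_alt23 x y z : pats x y z + pats x z y = 0.
Proof. by rewrite /pats; zcancel. Qed.

Lemma pats_inner_left v w x y :
  (v ⊣ pats w x y) + (v ⊣ pats x w y) = 0.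
Proof.
by rewrite /pats !dE ?(=^~ dbar_right, =^~ dleftA); zcancel.
Qed.

Lemma pats_inner_right v w x y :
  (pats w x y ⊢ v) + (pats x w y ⊢ v) = 0.
Proof.
by rewrite /pats !dE ?(dbar_left, drightA); zcancel.
Qed.

Lemma pats_alt_inner v w x y z :
  pats v (pats w x y) z + pats v (pats x w y) z = 0.
Proof.
rewrite -(scale1r (pats v (pats w x y) z)) -(pats_linear2 v z) scale1r.
set u := _ + _.
have ul t : t ⊣ u = 0 by rewrite dleftDr pats_inner_left.
have ur t : u ⊢ t = 0 by rewrite drightDl pats_inner_right.
pose uE := (ul, ur, dleft0l, dright0l, dright0r).
rewrite /pats ?uE ?(dleftA, drightA, drightleftA) ?uE.
by rewrite !(subr0, add0r, addr0).
Qed.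
End PATSisPATA.

Definition pats_of (D : Type) : Type := D.

HB.instance Definition _ (D : dialgebraType) := GRing.Lmodule.on (pats_of D).
HB.instance Definition _ (D : dialgebraType) :=
  Lmodule_isTernary.Build (pats_of D)
    (@pats_linear1 D) (@pats_linear2 D) (@pats_linear3 D).
HB.instance Definition _ (D : dialgebraType) :=
  Ternary_isPATA.Build (pats_of D) (@pats_alt23 D) (@pats_alt_inner D).

Inductive tmon (X : Type) : Type :=
| TVar of X
| TMul of tmon X & tmon X & tmon X.

Section MonomialChoice.
Variable X : Type.

Fixpoint tmon_encode (t : tmon X) : GenTree.tree X :=
  match t with
  | TVar x => GenTree.Leaf x
  | TMul t1 t2 t3 =>
      GenTree.Node 0 [:: tmon_encode t1; tmon_encode t2; tmon_encode t3]
  end.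

Fixpoint tmon_decode (t : GenTree.tree X) : option (tmon X) :=
  match t with
  | GenTree.Leaf x => Some (TVar x)
  | GenTree.Node _ [:: t1; t2; t3] =>
      match tmon_decode t1, tmon_decode t2, tmon_decode t3 with
      | Some u1, Some u2, Some u3 => Some (TMul u1 u2 u3)
      | _, _, _ => None
      end
  | _ => None
  end.

Lemma tmon_encodeK : pcancel tmon_encode tmon_decode.
Proof. by elim=> //= t1 -> t2 -> t3 ->. Qed.
End MonomialChoice.

HB.instance Definition _ (X : choiceType) :=
  Choice.copy (tmon X) (pcan_type (@tmon_encodeK X)).

Fixpoint leaves (X : Type) (t : tmon X) : seq X :=
  match t with
  | TVar x => [:: x]
  | TMul t1 t2 t3 => leaves t1 ++ leaves t2 ++ leaves t3
  end.

(* The free ternary algebra on X is {malg rat[tmon X]}, the vector space with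
   basis the ternary monomials. *)
Section FreeTernary.
Variable X : choiceType.
Local Notation FT := {malg rat[tmon X]}.

Definition lin_ext (W : lmodType rat) (phi : tmon X -> W) (f : FT) : W :=
  \sum_(t <- msupp f) f@_t *: phi t.

Lemma lin_extw (W : lmodType rat) (phi : tmon X -> W) (f : FT)
    (d : {fset tmon X}) :
  fsubset (msupp f) d -> lin_ext phi f = \sum_(t <- d) f@_t *: phi t.
Proof.
move=> fd; rewrite /lin_ext (big_fset_incl _ fd) //= => t _ /mcoeff_outdom ->.
by rewrite scale0r.
Qed.

Lemma lin_ext_is_linear (W : lmodType rat) (phi : tmon X -> W) :
  linear (lin_ext phi).
Proof.
move=> c f g.
pose d := fsetU (msupp f) (msupp g).
have fd : fsubset (msupp f) d by exact: fsubsetUl.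
have gd : fsubset (msupp g) d by exact: fsubsetUr.
have hd : fsubset (msupp (c *: f + g)) d.
  apply: fsubset_trans (msuppD_le _ _) _.
  by rewrite fsetSU // msuppZ_le.
rewrite (lin_extw phi fd) (lin_extw phi gd) (lin_extw phi hd).
rewrite scaler_sumr -big_split /=; apply: eq_bigr => t _.
by rewrite mcoeffD mcoeffZ scalerDl scalerA.
Qed.

Lemma lin_extU (W : lmodType rat) (phi : tmon X -> W) c t :
  lin_ext phi << c *g t >> = c *: phi t.
Proof. by rewrite (lin_extw phi msuppU_le) big_seq_fset1 mcoeffUU. Qed.

Lemma malgUZ c t : << c *g t >> = c *: (<< t >> : FT).
Proof.
apply/malgP => s; rewrite mcoeffZ [LHS]mcoeffU [X in c * X]mcoeffU.
by rewrite mulrnAr mulr1.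
Qed.

Lemma lin_ext_linear_fun (W W' : lmodType rat) (h : tmon X -> W -> W') f :
  (forall t, linear (h t)) -> linear (fun w => lin_ext (h^~ w) f).
Proof.
move=> hl c u v; rewrite /lin_ext scaler_sumr -big_split /=.
by apply: eq_bigr => t _; rewrite hl scalerDr !scalerA mulrC.
Qed.

(* Locked, as unfolding it makes conversion tests intractable. *)
Fact free_tprod_key : unit. Proof. by []. Qed.

Definition free_tprod : FT -> FT -> FT -> FT :=
  locked_with free_tprod_key (fun f g h =>
    lin_ext (fun s => lin_ext (fun t => lin_ext (fun u =>
      << TMul s t u >>) h) g) f).

Lemma free_tprodE f g h : free_tprod f g h =
  lin_ext (fun s => lin_ext (fun t => lin_ext (fun u =>
    << TMul s t u >>) h) g) f.
Proof. by rewrite /free_tprod unlock. Qed.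

Lemma free_tprod_linear1 g h : linear (fun f => free_tprod f g h).
Proof. by rewrite /free_tprod unlock; exact: lin_ext_is_linear. Qed.

Lemma free_tprod_linear2 f h : linear (fun g => free_tprod f g h).
Proof.
rewrite /free_tprod unlock.
apply: (lin_ext_linear_fun (h := fun s g => lin_ext _ g)) => s.
exact: lin_ext_is_linear.
Qed.

Lemma free_tprod_linear3 f g : linear (free_tprod f g).
Proof.
rewrite /free_tprod unlock.
apply: (lin_ext_linear_fun (h := fun s h => lin_ext _ g)) => s.
apply: (lin_ext_linear_fun (h := fun t h => lin_ext _ h)) => t.
exact: lin_ext_is_linear.
Qed.

HB.instance Definition _ := Lmodule_isTernary.Build FT
  free_tprod_linear1 free_tprod_linear2 free_tprod_linear3.

Lemma free_tprodU (s t u : tmon X) :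
  [tp (<< s >> : FT), << t >>, << u >>] = << TMul s t u >>.
Proof. by rewrite [LHS]free_tprodE !lin_extU !scale1r. Qed.

Section Evaluation.
Variables (A : ternaryType) (v : X -> A).

Fixpoint tmon_eval (t : tmon X) : A :=
  match t with
  | TVar x => v x
  | TMul t1 t2 t3 => [tp tmon_eval t1, tmon_eval t2, tmon_eval t3]
  end.

Definition free_eval : FT -> A := lin_ext tmon_eval.

Lemma free_evalD f g : free_eval (f + g) = free_eval f + free_eval g.
Proof. by have := lin_ext_is_linear tmon_eval 1 f g; rewrite !scale1r. Qed.

Lemma free_eval0 : free_eval 0 = 0.
Proof. by rewrite /free_eval /lin_ext msupp0 big_seq_fset0. Qed.

Lemma free_evalZ c f : free_eval (c *: f) = c *: free_eval f.
Proof.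
have := lin_ext_is_linear tmon_eval c f 0.
by rewrite -!/(free_eval _) free_eval0 !addr0.
Qed.

Lemma free_eval_sum I (r : seq I) (F : I -> FT) :
  free_eval (\sum_(i <- r) F i) = \sum_(i <- r) free_eval (F i).
Proof. exact: (big_morph _ free_evalD free_eval0). Qed.

Lemma tprod_suml (B : ternaryType) I (r : seq I) (F : I -> B) y z :
  [tp \sum_(i <- r) F i, y, z] = \sum_(i <- r) [tp F i, y, z].
Proof.
exact: (big_morph (fun x => tprod x y z) (fun x x' => tprodD1 x x' y z)
  (tprod0_1 y z)).
Qed.

Lemma tprod_summ (B : ternaryType) I (r : seq I) (F : I -> B) x z :
  [tp x, \sum_(i <- r) F i, z] = \sum_(i <- r) [tp x, F i, z].
Proof.
exact: (big_morph (fun y => tprod x y z) (fun y y' => tprodD2 x y y' z)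
  (tprod0_2 x z)).
Qed.

Lemma tprod_sumr (B : ternaryType) I (r : seq I) (F : I -> B) x y :
  [tp x, y, \sum_(i <- r) F i] = \sum_(i <- r) [tp x, y, F i].
Proof.
exact: (big_morph (fun z => tprod x y z) (tprodD3 x y) (tprod0_3 x y)).
Qed.

Lemma free_evalM f g h :
  free_eval [tp f, g, h] = [tp free_eval f, free_eval g, free_eval h].
Proof.
rewrite [X in free_eval X]free_tprodE {1}/lin_ext free_eval_sum.
rewrite [in RHS]/free_eval {1}[in RHS]/lin_ext tprod_suml.
apply: eq_bigr => s _; rewrite free_evalZ tprodZ1; congr (_ *: _).
rewrite {1}/lin_ext free_eval_sum {1}[in RHS]/lin_ext tprod_summ.
apply: eq_bigr => t _; rewrite free_evalZ tprodZ2; congr (_ *: _).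
rewrite {1}/lin_ext free_eval_sum {1}[in RHS]/lin_ext tprod_sumr.
apply: eq_bigr => u _; rewrite free_evalZ tprodZ3; congr (_ *: _).
by rewrite /free_eval lin_extU scale1r.
Qed.
End Evaluation.

Inductive pata_consequence : FT -> Prop :=
| PataAlt23 x y z : pata_consequence ([tp x, y, z] + [tp x, z, y])
| PataAltInner v w x y z :
    pata_consequence ([tp v, [tp w, x, y], z] + [tp v, [tp x, w, y], z])
| PataC0 : pata_consequence 0
| PataCD f g :
    pata_consequence f -> pata_consequence g -> pata_consequence (f + g)
| PataCZ c f : pata_consequence f -> pata_consequence (c *: f)
| PataC1 f y z : pata_consequence f -> pata_consequence [tp f, y, z]
| PataC2 f x z : pata_consequence f -> pata_consequence [tp x, f, z]
| PataC3 f x y : pata_consequence f -> pata_consequence [tp x, y, f].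

Definition pata_ideal : {pred FT} := fun f => `[< pata_consequence f >].

Lemma pata_idealP f : reflect (pata_consequence f) (f \in pata_ideal).
Proof. exact: asboolP. Qed.

Lemma pata_ideal_zmod_closed : zmod_closed pata_ideal.
Proof.
split=> [|f g /pata_idealP fI /pata_idealP gI]; apply/pata_idealP.
  exact: PataC0.
by apply: PataCD => //; rewrite -scaleN1r; exact: PataCZ.
Qed.

HB.instance Definition _ :=
  GRing.isZmodClosed.Build FT pata_ideal pata_ideal_zmod_closed.

Definition freePATA : Type := Quotient.quot pata_ideal.

HB.instance Definition _ := ZmodQuotient.on freePATA.

(* Locked for the same reason as free_tprod. *)
Fact pata_key : unit. Proof. by []. Qed.

Definition pata_class : FT -> freePATA :=
  locked_with pata_key (fun f => \pi_freePATA f).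

Lemma pata_classE f : pata_class f = \pi_freePATA f.
Proof. by rewrite /pata_class unlock. Qed.

Lemma pata_classP f g : pata_class f = pata_class g <-> pata_consequence (f - g).
Proof.
rewrite !pata_classE; split=> [/eqP|fg].
  by rewrite -Quotient.idealrBE => /pata_idealP.
by apply/eqP; rewrite -Quotient.idealrBE; apply/pata_idealP.
Qed.

Lemma pata_classK (x : freePATA) : pata_class (repr x) = x.
Proof. by rewrite pata_classE reprK. Qed.

Lemma pata_classW (P : freePATA -> Prop) :
  (forall f, P (pata_class f)) -> forall x, P x.
Proof. by move=> Pf x; rewrite -[x]pata_classK. Qed.

Lemma pata_classD f g : pata_class (f + g) = pata_class f + pata_class g.
Proof. by rewrite !pata_classE; exact: pi_addr. Qed.

Definition pata_scale : rat -> freePATA -> freePATA :=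
  locked_with pata_key (fun c x => pata_class (c *: repr x)).

Lemma pata_class_scale c f : pata_class (c *: f) = pata_scale c (pata_class f).
Proof.
rewrite /pata_scale unlock; apply/pata_classP; rewrite -scalerBr.
by apply: PataCZ; apply/pata_classP; rewrite pata_classK.
Qed.

Lemma pata_scaleA c d x : pata_scale c (pata_scale d x) = pata_scale (c * d) x.
Proof. by elim/pata_classW: x => f; rewrite -!pata_class_scale scalerA. Qed.

Lemma pata_scale1 : left_id 1 pata_scale.
Proof. by elim/pata_classW => f; rewrite -pata_class_scale scale1r. Qed.

Lemma pata_scaleDr : right_distributive pata_scale +%R.
Proof.
move=> c; elim/pata_classW => f; elim/pata_classW => g.
by rewrite -!pata_class_scale -!pata_classD -pata_class_scale scalerDr.
Qed.

Lemma pata_scaleDl x : {morph pata_scale^~ x : c d / c + d}.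
Proof.
move=> c d /=; elim/pata_classW: x => f.
by rewrite -!pata_class_scale -pata_classD scalerDl.
Qed.

HB.instance Definition _ := GRing.Zmodule_isLmodule.Build rat freePATA
  pata_scaleA pata_scale1 pata_scaleDr pata_scaleDl.

Lemma pata_class_is_linear : linear pata_class.
Proof. by move=> c f g; rewrite pata_classD pata_class_scale. Qed.

HB.instance Definition _ :=
  GRing.isLinear.Build rat FT freePATA _ pata_class pata_class_is_linear.

Lemma pata_classZ c f : pata_class (c *: f) = c *: pata_class f.
Proof. exact: pata_class_scale. Qed.

Lemma pata_class0 : pata_class 0 = 0.
Proof. by apply: (addIr (pata_class 0)); rewrite -pata_classD !add0r. Qed.

Definition pata_tprod : freePATA -> freePATA -> freePATA -> freePATA :=
  locked_with pata_key
    (fun x y z => pata_class [tp repr x, repr y, repr z]).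

Lemma pata_class_tprod f g h :
  pata_class [tp f, g, h] =
  pata_tprod (pata_class f) (pata_class g) (pata_class h).
Proof.
rewrite /pata_tprod unlock.
have reprB k : pata_consequence (k - repr (pata_class k)).
  by apply/pata_classP; rewrite pata_classK.
transitivity (pata_class [tp repr (pata_class f), g, h]).
  by apply/pata_classP; rewrite -tprodN1 -tprodD1; exact: PataC1.
transitivity (pata_class [tp repr (pata_class f), repr (pata_class g), h]).
  by apply/pata_classP; rewrite -tprodN2 -tprodD2; exact: PataC2.
by apply/pata_classP; rewrite -tprodN3 -tprodD3; exact: PataC3.
Qed.

Lemma pata_tprod_linear1 y z : linear (fun x => pata_tprod x y z).
Proof.
move=> c; elim/pata_classW: y => g; elim/pata_classW: z => h.
elim/pata_classW => f; elim/pata_classW => f'.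
rewrite -pata_class_is_linear -!pata_class_tprod tprodD1 tprodZ1.
exact: pata_class_is_linear.
Qed.

Lemma pata_tprod_linear2 x z : linear (fun y => pata_tprod x y z).
Proof.
move=> c; elim/pata_classW: x => g; elim/pata_classW: z => h.
elim/pata_classW => f; elim/pata_classW => f'.
rewrite -pata_class_is_linear -!pata_class_tprod tprodD2 tprodZ2.
exact: pata_class_is_linear.
Qed.

Lemma pata_tprod_linear3 x y : linear (pata_tprod x y).
Proof.
move=> c; elim/pata_classW: x => g; elim/pata_classW: y => h.
elim/pata_classW => f; elim/pata_classW => f'.
rewrite -pata_class_is_linear -!pata_class_tprod tprodD3 tprodZ3.
exact: pata_class_is_linear.
Qed.

HB.instance Definition _ := Lmodule_isTernary.Build freePATA
  pata_tprod_linear1 pata_tprod_linear2 pata_tprod_linear3.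

Lemma pata_classM f g h :
  pata_class [tp f, g, h] = [tp pata_class f, pata_class g, pata_class h].
Proof. exact: pata_class_tprod. Qed.

Lemma freePATA_alt23 (x y z : freePATA) : [tp x, y, z] + [tp x, z, y] = 0.
Proof.
elim/pata_classW: x => f; elim/pata_classW: y => g; elim/pata_classW: z => h.
rewrite -!pata_classM -pata_classD -pata_class0.
by apply/pata_classP; rewrite subr0; exact: PataAlt23.
Qed.

Lemma freePATA_alt_inner (v w x y z : freePATA) :
  [tp v, [tp w, x, y], z] + [tp v, [tp x, w, y], z] = 0.
Proof.
elim/pata_classW: v => e; elim/pata_classW: w => f; elim/pata_classW: x => g.
elim/pata_classW: y => h; elim/pata_classW: z => k.
rewrite -!pata_classM -pata_classD -pata_class0.
by apply/pata_classP; rewrite subr0; exact: PataAltInner.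
Qed.

HB.instance Definition _ :=
  Ternary_isPATA.Build freePATA freePATA_alt23 freePATA_alt_inner.

Definition pata_gen (x : X) : freePATA := pata_class << TVar x >>.

Lemma free_eval_consequence (P : pataType) (v : X -> P) f :
  pata_consequence f -> free_eval v f = 0.
Proof.
elim=> {f} [x y z|u w x y z||f g _ ef _ eg|c f _ ef|f y z _ ef|f x z _ ef
  |f x y _ ef].
- by rewrite free_evalD !free_evalM pata_alt23.
- by rewrite free_evalD !free_evalM pata_alt_inner.
- exact: free_eval0.
- by rewrite free_evalD ef eg addr0.
- by rewrite free_evalZ ef scaler0.
- by rewrite free_evalM ef tprod0_1.
- by rewrite free_evalM ef tprod0_2.
- by rewrite free_evalM ef tprod0_3.
Qed.

(* The value of an element of the free PATA; by the next four lemmas this is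
   the unique morphism of ternary algebras extending v. *)
Definition pata_eval (P : pataType) (v : X -> P) (x : freePATA) : P :=
  free_eval v (repr x).

Section PataEval.
Variables (P : pataType) (v : X -> P).

Lemma pata_eval_class f : pata_eval v (pata_class f) = free_eval v f.
Proof.
apply/eqP; rewrite -subr_eq0 -scaleN1r -free_evalZ -free_evalD scaleN1r.
apply/eqP/free_eval_consequence/pata_classP.
exact: pata_classK.
Qed.

Lemma pata_eval_is_linear : linear (pata_eval v).
Proof.
move=> c; elim/pata_classW => f; elim/pata_classW => g.
by rewrite -pata_class_is_linear !pata_eval_class free_evalD free_evalZ.
Qed.

Lemma pata_evalM x y z :
  pata_eval v [tp x, y, z] = [tp pata_eval v x, pata_eval v y, pata_eval v z].
Proof.
elim/pata_classW: x => f; elim/pata_classW: y => g; elim/pata_classW: z => h.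
by rewrite -pata_classM !pata_eval_class free_evalM.
Qed.

Lemma pata_eval_gen x : pata_eval v (pata_gen x) = v x.
Proof. by rewrite pata_eval_class /free_eval lin_extU scale1r. Qed.

Lemma pata_eval_unique (phi : freePATA -> P) :
  linear phi -> (forall x y z, phi [tp x, y, z] = [tp phi x, phi y, phi z]) ->
  (forall x, phi (pata_gen x) = v x) -> phi =1 pata_eval v.
Proof.
move=> phil phiM phig; elim/pata_classW => f; rewrite pata_eval_class.
have phiD y z : phi (y + z) = phi y + phi z.
  by have := phil 1 y z; rewrite !scale1r.
have phi0 : phi 0 = 0 by apply: (addIr (phi 0)); rewrite -phiD !add0r.
have phiZ c y : phi (c *: y) = c *: phi y.
  by have := phil c y 0; rewrite phi0 !addr0.
rewrite [in LHS](monalgE f) (big_morph _ pata_classD pata_class0)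
  (big_morph phi phiD phi0).
apply: eq_bigr => t _.
rewrite malgUZ pata_classZ phiZ; congr (_ *: _).
elim: t => [y|t1 e1 t2 e2 t3 e3] /=; first exact: phig.
by rewrite -free_tprodU pata_classM phiM e1 e2 e3.
Qed.
End PataEval.

Definition satisfied_by_pats (f : freePATA) : Prop :=
  forall (D : dialgebraType) (v : X -> pats_of D), pata_eval v f = 0.

(* The span of the monomials whose variables are a permutation of s. *)
Definition component (s : seq X) (f : freePATA) : Prop :=
  exists2 g : FT, (forall t, t \in msupp g -> perm_eq (leaves t) s)
                & f = pata_class g.
End FreeTernary.

(* Their classes are a basis of the degree 7 part of the free PATA on 'I_n. *)
Definition straightened7 (n : nat) (t : tmon 'I_n) : bool :=
  match t with
  | TMul (TMul (TMul (TVar x1) (TVar x2) (TVar x3)) (TVar x4) (TVar x5))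
         (TVar x6) (TVar x7) =>
      [&& x2 < x3, x4 < x5 & x6 < x7]%N
  | TMul (TMul (TVar x1) (TMul (TVar x2) (TVar x3) (TVar x4)) (TVar x5))
         (TVar x6) (TVar x7) =>
      [&& x2 < x3, x3 < x4 & x6 < x7]%N
  | TMul (TMul (TVar x1) (TVar x2) (TVar x3))
         (TMul (TVar x4) (TVar x5) (TVar x6)) (TVar x7) =>
      [&& x2 < x3, x4 < x5 & x5 < x6]%N
  | TMul (TVar x1)
         (TMul (TMul (TVar x2) (TVar x3) (TVar x4)) (TVar x5) (TVar x6))
         (TVar x7) =>
      [&& x2 < x3, x3 < x4 & x5 < x6]%N
  | TMul (TVar x1) (TMul (TVar x2) (TVar x3) (TVar x4))
         (TMul (TVar x5) (TVar x6) (TVar x7)) =>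
      [&& x2 < x3, x3 < x4, x5 < x6, x6 < x7
        & (x2 < x5) || (x2 == x5) &&
          ((x3 < x6) || (x3 == x6) && (x4 < x7))]%N
  | _ => false
  end.

Definition straightened_form (n : nat) (f : freePATA 'I_n)
    (g : {malg rat[tmon 'I_n]}) : Prop :=
  (forall t, t \in msupp g -> straightened7 t) /\ f = pata_class g.

(* f has exactly k terms: it has a unique expression in the straightened
   monomials of degree 7, and k coefficients of it are nonzero. *)
Definition number_of_terms (n : nat) (f : freePATA 'I_n) (k : nat) : Prop :=
  exists2 g, unique (straightened_form f) g & size (msupp g) = k.

Definition is_basis_of (L : lmodType rat) (N : L -> Prop) (k : nat)
    (v : k.-tuple L) : Prop :=
  (forall f, N f <-> exists c : 'I_k -> rat, f = \sum_i c i *: tnth v i) /\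
  (forall c : 'I_k -> rat, \sum_i c i *: tnth v i = 0 -> forall i, c i = 0).

Section Partition22111.

Definition va : 'I_5 := @Ordinal 5 0 isT.
Definition vb : 'I_5 := @Ordinal 5 1 isT.
Definition vc : 'I_5 := @Ordinal 5 2 isT.
Definition vd : 'I_5 := @Ordinal 5 3 isT.
Definition ve : 'I_5 := @Ordinal 5 4 isT.

Definition V22111 : freePATA 'I_5 -> Prop :=
  component [:: va; va; vb; vb; vc; vd; ve].

Definition N22111 (f : freePATA 'I_5) : Prop :=
  V22111 f /\ satisfied_by_pats f.

Local Notation a := (pata_gen va).
Local Notation b := (pata_gen vb).
Local Notation "x ^^ s" := (pata_gen ((s : 'S_5) x)) (at level 2).

Definition alt_sum (F : 'S_5 -> freePATA 'I_5) : freePATA 'I_5 :=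
  \sum_(s : 'S_5) (-1) ^+ s *: F s.

Definition I22111_1 : freePATA 'I_5 :=
    4%:R^-1 *: alt_sum (fun s =>
      [tp [tp [tp a, va^^s, vb^^s], b, vc^^s], vd^^s, ve^^s])
  - 12%:R^-1 *: alt_sum (fun s =>
      [tp [tp a, [tp va^^s, vb^^s, vc^^s], b], vd^^s, ve^^s])
  - 12%:R^-1 *: alt_sum (fun s =>
      [tp [tp a, va^^s, vb^^s], [tp vc^^s, vd^^s, ve^^s], b])
  - 6%:R^-1 *: alt_sum (fun s =>
      [tp a, [tp [tp va^^s, vb^^s, vc^^s], b, vd^^s], ve^^s]).

(* Interchanging a and b in the formula is applying the endomorphism of the
   free PATA which exchanges these two generators. *)
Definition I22111_2 : freePATA 'I_5 :=
  pata_eval (fun x => pata_gen (tperm va vb x)) I22111_1.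

End Partition22111.

(* Main.v *)
(* In [x, y, z] the arguments y and z only enter through classes on which the
   product is fully alternating. Hence a free PATA is spanned by monomials whose
   inner arguments are sorted, and the coordinates on them are well defined: on
   pairs of functions of the monomials, "outer" and "inner", 2x2 and 3x3
   determinants give a PATA structure in which distinct sorted monomials are
   orthonormal. This gives the unique straightened form and a basis of 330
   monomials of the component 22111.

   In any dialgebra the PATS sends a monomial to a signed sum of words with a
   centre, which is the head letter of the monomial. Conversely, for an
   associative algebra A, the bimodule A + A is a dialgebra in which these words
   are linearly independent when A is free. So the coordinates of an identity
   satisfy one linear equation per word. Integer elimination on 328 of these
   equations, together with the vanishing of the coordinates on one monomial of
   each identity, leaves only zero, so the two identities span. *)

From HB Require Import structures.
From Stdlib Require Import ZArith.
From mathcomp Require Import all_boot all_algebra all_fingroup.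
From mathcomp Require Import finmap monalg.
From mathcomp Require Import boolp functions ssrZ zify ring.
Require Import Defs.

Set Implicit Arguments.
Unset Strict Implicit.
Unset Printing Implicit Defensive.

Import GRing.Theory.

Local Open Scope ring_scope.

(** * Straightening *)

Section MonomialOrder.
Variable n : nat.
Local Notation mon := (tmon 'I_n).
Implicit Types s t u x y z : mon.

(** A structural test meant for evaluation: the generic [==] on monomials goes through their
    encoding as generic trees. *)
Fixpoint teq s t : bool :=
  match s, t with
  | TVar i, TVar j => eqn i j
  | TMul s1 s2 s3, TMul t1 t2 t3 => [&& teq s1 t1, teq s2 t2 & teq s3 t3]
  | _, _ => false
  end.

Lemma teqE s t : teq s t = (s == t).
Proof.
apply/idP/eqP => [|->]; last by elim: t => [i|t1 h1 t2 h2 t3 h3] /=;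
  rewrite ?eqnE ?eqxx ?h1 ?h2.
elim: s t => [i|s1 h1 s2 h2 s3 h3] [j|t1 t2 t3] //=.
  by move=> /eqP /val_inj ->.
by case/and3P=> /h1 -> /h2 -> /h3 ->.
Qed.

(* Composite monomials precede variables, as in the straightened monomials. *)
Fixpoint tlt s t : bool :=
  match s, t with
  | TVar i, TVar j => (i < j)%N
  | TVar _, TMul _ _ _ => false
  | TMul _ _ _, TVar _ => true
  | TMul s1 s2 s3, TMul t1 t2 t3 =>
      tlt s1 t1 ||
      (teq s1 t1 && (tlt s2 t2 || (teq s2 t2 && tlt s3 t3)))
  end.

Lemma tlt_irr t : tlt t t = false.
Proof.
by elim: t => [i|t1 h1 t2 h2 t3 h3] /=; rewrite ?ltnn ?h1 ?h2 ?h3 ?andbF.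
Qed.

Lemma tlt_trans : transitive tlt.
Proof.
move=> t; elim: t => [j|t1 h1 t2 h2 t3 h3] [i|s1 s2 s3] [k|u1 u2 u3] //=.
  exact: ltn_trans.
rewrite !teqE.
case/orP=> [a|/andP[/eqP <- a]]; case/orP=> [b|/andP[/eqP <- b]].
- by rewrite (h1 _ _ a b).
- by rewrite a.
- by rewrite b.
- rewrite eqxx; apply/orP; right; rewrite /=.
  move: a b.
  case/orP=> [a|/andP[/eqP <- a]]; case/orP=> [b|/andP[/eqP <- b]].
  + by rewrite (h2 _ _ a b).
  + by rewrite a.
  + by rewrite b.
  + by rewrite eqxx (h3 _ _ a b) orbT.
Qed.

Lemma tlt_total s t : [|| tlt s t, s == t | tlt t s].
Proof.
elim: s t => [i|s1 h1 s2 h2 s3 h3] [j|t1 t2 t3] //=.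
  by rewrite -teqE /= eqnE; case: ltngtP.
rewrite -[TMul _ _ _ == _]teqE /= !teqE.
case/or3P: (h1 t1) => [->|/eqP <-|->] //; last by rewrite !orbT.
rewrite !eqxx !tlt_irr /=.
case/or3P: (h2 t2) => [->|/eqP <-|->] //; last by rewrite !orbT.
rewrite !eqxx !tlt_irr /=.
by case/or3P: (h3 t3) => [->|/eqP <-|->]; rewrite ?eqxx ?orbT.
Qed.

Lemma tlt_asym s t : tlt s t -> tlt t s = false.
Proof.
by move=> a; apply/negP => b; have := tlt_trans a b; rewrite tlt_irr.
Qed.

(* The boolean is the sign; None stands for a monomial with a repetition. *)
Definition sort2 y z : option (bool * (mon * mon)) :=
  if tlt y z then Some (false, (y, z))
  else if tlt z y then Some (true, (z, y)) else None.

Definition sort3 x y z : option (bool * (mon * mon * mon)) :=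
  if sort2 y z is Some (b, (y, z)) then
    if tlt x y then Some (b, (x, y, z)) else
    if tlt y x then
      if tlt x z then Some (~~ b, (y, x, z)) else
      if tlt z x then Some (b, (y, z, x)) else None
    else None
  else None.

Definition signed (V : Type) (W : lmodType rat) (F : V -> W)
  (o : option (bool * V)) : W :=
  if o is Some (b, v) then (-1) ^+ b *: F v else 0.

(** Normal form of an inner argument, where the three entries of every product may be permuted
    freely. [nfO] below treats a whole monomial, whose head stays in first place while the other two
    arguments are inner. *)
Fixpoint nfA t : option (bool * mon) :=
  match t with
  | TVar _ => Some (false, t)
  | TMul t1 t2 t3 =>
      if nfA t1 is Some (b1, u1) then
      if nfA t2 is Some (b2, u2) then
      if nfA t3 is Some (b3, u3) then
      if sort3 u1 u2 u3 is Some (b, (v1, v2, v3)) then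
        Some (b1 (+) b2 (+) b3 (+) b, TMul v1 v2 v3)
      else None else None else None else None
  end.

Fixpoint nfO t : option (bool * mon) :=
  match t with
  | TVar _ => Some (false, t)
  | TMul t1 t2 t3 =>
      if nfO t1 is Some (b1, u1) then
      if nfA t2 is Some (b2, u2) then
      if nfA t3 is Some (b3, u3) then
      if sort2 u2 u3 is Some (b, (v2, v3)) then
        Some (b1 (+) b2 (+) b3 (+) b, TMul u1 v2 v3)
      else None else None else None else None
  end.

Fixpoint canA t : bool :=
  if t is TMul t1 t2 t3 then
    [&& canA t1, canA t2, canA t3, tlt t1 t2 & tlt t2 t3]
  else true.

Fixpoint canO t : bool :=
  if t is TMul t1 t2 t3 then [&& canO t1, canA t2, canA t3 & tlt t2 t3]
  else true.

Lemma sort2_perm y z b p : sort2 y z = Some (b, p) ->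
  tlt p.1 p.2 /\ (p = (y, z) \/ p = (z, y)).
Proof.
rewrite /sort2; case: ifP => [a [_ <-]|_]; first by split=> //; left.
by case: ifP => [a [_ <-]|//]; split=> //; right.
Qed.

Lemma sort3_perm x y z b p : sort3 x y z = Some (b, p) ->
  [/\ tlt p.1.1 p.1.2, tlt p.1.2 p.2 &
      [\/ p.1.1 = x /\ (p.1.2, p.2) = (y, z) \/
          p.1.1 = x /\ (p.1.2, p.2) = (z, y),
          p.1.2 = x /\ (p.1.1, p.2) = (y, z) \/
          p.1.2 = x /\ (p.1.1, p.2) = (z, y) |
          p.2 = x /\ (p.1.1, p.1.2) = (y, z) \/
          p.2 = x /\ (p.1.1, p.1.2) = (z, y)]].
Proof.
rewrite /sort3; case e: sort2 => [[c [y' z']]|] //.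
have [lyz yz] := sort2_perm e.
case: ifP => [a [_ <-]|_].
  by split=> //; apply: Or31; case: yz => ->; [left|right].
case: ifP => [a|//]; case: ifP => [a' [_ <-]|_].
  by split=> //; apply: Or32; case: yz => ->; [left|right].
case: ifP => [a' [_ <-]|//].
by split=> //; apply: Or33; case: yz => ->; [left|right].
Qed.

Lemma sort3_all (P : mon -> Prop) x y z b x' y' z' :
  sort3 x y z = Some (b, (x', y', z')) -> P x -> P y -> P z ->
  [/\ P x', P y' & P z'].
Proof.
by move/sort3_perm=> /= [_ _ [] []] [-> [-> ->]].
Qed.

Lemma sort3_leaves x y z b x' y' z' :
  sort3 x y z = Some (b, (x', y', z')) ->
  perm_eq (leaves (TMul x' y' z')) (leaves (TMul x y z)).
Proof.
case/sort3_perm=> /= _ _ h.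
have e (p q r : seq 'I_n) (f : pred 'I_n) : count f (p ++ q ++ r) =
  (count f p + (count f q + count f r))%N by rewrite !count_cat.
apply/seq.permP=> f; rewrite !e.
by case: h => [] [] [-> [-> ->]]; lia.
Qed.

Lemma nfA_can t b u : nfA t = Some (b, u) -> canA u.
Proof.
elim: t b u => [i|t1 h1 t2 h2 t3 h3] b u /=; first by case=> _ <-.
case: (nfA t1) h1 => [[b1 u1]|] // h1; case: (nfA t2) h2 => [[b2 u2]|] // h2.
case: (nfA t3) h3 => [[b3 u3]|] // h3.
case e: sort3 => [[c [[v1 v2] v3]]|] // [_ <-] /=.
have [-> -> _] := sort3_perm e.
have [] := sort3_all (P := fun t => is_true (canA t)) e
  (h1 _ _ erefl) (h2 _ _ erefl) (h3 _ _ erefl).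
by move=> -> -> ->.
Qed.

Lemma nfO_can t b u : nfO t = Some (b, u) -> canO u.
Proof.
elim: t b u => [i|t1 h1 t2 _ t3 _] b u /=; first by case=> _ <-.
case: (nfO t1) h1 => [[b1 u1]|] // h1; case e2: (nfA t2) => [[b2 u2]|] //.
case e3: (nfA t3) => [[b3 u3]|] //.
case e: sort2 => [[c [v2 v3]]|] // [_ <-] /=.
rewrite (h1 _ _ erefl) /=; have [-> [] [-> ->]] := sort2_perm e.
all: by rewrite (nfA_can e2) (nfA_can e3).
Qed.

Lemma nfA_leaves t b u : nfA t = Some (b, u) -> perm_eq (leaves u) (leaves t).
Proof.
elim: t b u => [i|t1 h1 t2 h2 t3 h3] b u /=; first by case=> _ <-.
case: (nfA t1) h1 => [[b1 u1]|] // h1; case: (nfA t2) h2 => [[b2 u2]|] // h2.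
case: (nfA t3) h3 => [[b3 u3]|] // h3.
case e: sort3 => [[c [[v1 v2] v3]]|] // [_ <-].
apply: perm_trans (sort3_leaves e) _.
by rewrite /= !perm_cat ?(h1 _ _ erefl) ?(h2 _ _ erefl) ?(h3 _ _ erefl).
Qed.

Lemma nfO_leaves t b u : nfO t = Some (b, u) -> perm_eq (leaves u) (leaves t).
Proof.
elim: t b u => [i|t1 h1 t2 _ t3 _] b u /=; first by case=> _ <-.
case: (nfO t1) h1 => [[b1 u1]|] // h1; case e2: (nfA t2) => [[b2 u2]|] //.
case e3: (nfA t3) => [[b3 u3]|] //.
case e: sort2 => [[c [v2 v3]]|] // [_ <-] /=.
apply: perm_cat; first exact: h1 erefl.
have [_ [] [-> ->]] := sort2_perm e; last rewrite perm_catC.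
all: by rewrite perm_cat ?(nfA_leaves e2) ?(nfA_leaves e3).
Qed.

End MonomialOrder.

(** This makes antisymmetric maps vanish on repeated arguments: 2 is invertible in the rationals. *)
Lemma opp_fixed0 (W : lmodType rat) (w : W) : w = - w -> w = 0.
Proof.
move=> e; apply/eqP; have: 2%:R *: w == 0.
  by rewrite scaler_nat mulr2n {2}e subrr.
by rewrite scaler_eq0.
Qed.

Section AlternatingMaps.
Variables (n : nat) (W : lmodType rat).

Lemma sort2_signed (g : tmon 'I_n -> tmon 'I_n -> W) y z :
  (forall y z, g y z = - g z y) ->
  g y z = signed (fun p => g p.1 p.2) (sort2 y z).
Proof.
move=> alt; rewrite /sort2; case: ifP => [_|nyz]; first by rewrite /= scale1r.
case: ifP => [_|nzy]; first by rewrite /= scaleN1r.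
have /= := tlt_total y z; rewrite nyz nzy orbF => /eqP <-.
exact: opp_fixed0.
Qed.

Lemma sort3_signed (g : tmon 'I_n -> tmon 'I_n -> tmon 'I_n -> W) x y z :
  (forall x y z, g x y z = - g y x z) -> (forall x y z, g x y z = - g x z y) ->
  g x y z = signed (fun p => g p.1.1 p.1.2 p.2) (sort3 x y z).
Proof.
move=> alt1 alt2; rewrite /sort3 (sort2_signed y z (alt2 x)).
case: sort2 => [[b [{}y {}z]]|] //=.
case: ifP => [_|nxy] //=; case: ifP => [_|nyx] /=; last first.
  have /= := tlt_total x y; rewrite nxy nyx orbF => /eqP <-.
  by rewrite (opp_fixed0 (alt1 x x z)) scaler0.
rewrite alt1; case: ifP => [_|nxz] /=.
  by rewrite signrN scaleNr scalerN.
rewrite alt2 opprK; case: ifP => [_|nzx] //=.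
have /= := tlt_total x z; rewrite nxz nzx orbF => /eqP <-.
by rewrite (opp_fixed0 (alt2 y x x)) scaler0.
Qed.

End AlternatingMaps.

Section Straightening.
Variables (n : nat) (P : pataType) (v : 'I_n -> P).
Local Notation ev := (tmon_eval v).

Lemma pata_swap23 (x y z : P) : [tp x, y, z] = - [tp x, z, y].
Proof. by apply/eqP; rewrite -addr_eq0 pata_alt23. Qed.

Lemma pata_inner_swap12 (x a b c z : P) :
  [tp x, [tp a, b, c], z] = - [tp x, [tp b, a, c], z].
Proof. by apply/eqP; rewrite -addr_eq0 pata_alt_inner. Qed.

Lemma pata_inner_swap23 (x a b c z : P) :
  [tp x, [tp a, b, c], z] = - [tp x, [tp a, c, b], z].
Proof. by rewrite (pata_swap23 a) tprodN2. Qed.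

(** The context [[tp y, _, z]] is what makes [t] fully alternating. The induction quantifies over
    [y] and [z] because a product inside [t] offers such a context to its own middle entry. *)
Lemma nfA_correct t y z :
  [tp y, ev t, z] = signed (fun u => [tp y, ev u, z]) (nfA t).
Proof.
elim: t y z => [i|t1 h1 t2 h2 t3 h3] y z /=; first by rewrite scale1r.
(* The induction hypothesis applies in a second slot only: a swap brings [t1] there, and is undone
   afterwards. For [t3] the last two entries are swapped instead. *)
rewrite pata_inner_swap12 (h1 (ev t2)).
case: nfA => [[b1 u1]|] /=; last by rewrite tprod0_2 oppr0.
rewrite tprodZ2 -scalerN -pata_inner_swap12 (h2 (ev u1)).
case: nfA => [[b2 u2]|] /=; last by rewrite tprod0_2 scaler0.
rewrite tprodZ2 scalerA pata_inner_swap23 (h3 (ev u1)).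
case: nfA => [[b3 u3]|] /=; last by rewrite tprod0_2 oppr0 scaler0.
rewrite tprodZ2 -scalerN -pata_inner_swap23 scalerA.
rewrite (sort3_signed (g := fun a b c => [tp y, [tp ev a, ev b, ev c], z])).
- case: sort3 => [[b [[w1 w2] w3]]|] /=; last by rewrite scaler0.
  by rewrite scalerA !signr_addb.
- by move=> *; exact: pata_inner_swap12.
- by move=> *; exact: pata_inner_swap23.
Qed.

Lemma nfO_correct t : ev t = signed ev (nfO t).
Proof.
elim: t => [i|t1 h1 t2 _ t3 _] /=; first by rewrite scale1r.
rewrite {}h1; case: nfO => [[b1 u1]|] /=; last by rewrite tprod0_1.
rewrite tprodZ1 nfA_correct.
case: nfA => [[b2 u2]|] /=; last by rewrite scaler0.
rewrite scalerA pata_swap23 nfA_correct.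
case: nfA => [[b3 u3]|] /=; last by rewrite oppr0 scaler0.
rewrite -scalerN -pata_swap23 scalerA.
rewrite (sort2_signed (g := fun a b => [tp ev u1, ev a, ev b])); last first.
  by move=> *; exact: pata_swap23.
case: sort2 => [[b [w1 w2]]|] /=; last by rewrite scaler0.
by rewrite scalerA !signr_addb.
Qed.

End Straightening.

(** * Coordinates *)

(* Coordinate functions of an element: [u.1 t] is its coefficient on t when t is
   seen as a whole monomial, [u.2 t] when t is seen as a (fully alternating)
   inner argument. *)
Definition coord (n : nat) : Type :=
  ((tmon 'I_n -> rat^o) * (tmon 'I_n -> rat^o))%type.

HB.instance Definition _ n := GRing.Lmodule.on (coord n).

Section Coordinates.
Variable n : nat.
Local Notation mon := (tmon 'I_n).
Local Notation C := (coord n).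

Definition det2 (f g : mon -> rat) (s t : mon) : rat :=
  f s * g t - f t * g s.

Definition det3 (f g h : mon -> rat) (s t u : mon) : rat :=
  f s * g t * h u - f s * g u * h t - f t * g s * h u
  + f t * g u * h s + f u * g s * h t - f u * g t * h s.

Definition outer (x : C) (t : mon) : rat := x.1 t.
Definition inner (x : C) (t : mon) : rat := x.2 t.

Definition coord_tprod (x y z : C) : C :=
  (fun t => if t is TMul t1 t2 t3 then
     outer x t1 * det2 (inner y) (inner z) t2 t3 else 0,
   fun t => if t is TMul t1 t2 t3 then
     det3 (inner x) (inner y) (inner z) t1 t2 t3 else 0).

Lemma coordP (x y : C) : outer x =1 outer y -> inner x =1 inner y -> x = y.
Proof.
by case: x y => [f g] [f' g'] /funext /= e1 /funext /= e2; congr pair.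
Qed.

Lemma outerP c (x y : C) t : outer (c *: x + y) t = c * outer x t + outer y t.
Proof. by []. Qed.

Lemma innerP c (x y : C) t : inner (c *: x + y) t = c * inner x t + inner y t.
Proof. by []. Qed.

Lemma outerD (x y : C) t : outer (x + y) t = outer x t + outer y t.
Proof. by []. Qed.

Lemma innerD (x y : C) t : inner (x + y) t = inner x t + inner y t.
Proof. by []. Qed.

Lemma outerM x y z t : outer (coord_tprod x y z) t =
  if t is TMul t1 t2 t3 then
    outer x t1 * det2 (inner y) (inner z) t2 t3 else 0.
Proof. by []. Qed.

Lemma innerM x y z t : inner (coord_tprod x y z) t =
  if t is TMul t1 t2 t3 then
    det3 (inner x) (inner y) (inner z) t1 t2 t3 else 0.
Proof. by []. Qed.

Let coordE := (outerP, innerP, outerD, innerD, outerM, innerM).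

Lemma coord_linear1 y z : linear (fun x => coord_tprod x y z).
Proof.
move=> c x x'; apply: coordP => -[i|t1 t2 t3]; rewrite !coordE ?mulr0 ?addr0 //.
all: by rewrite /det2 /det3 ?coordE; ring.
Qed.

Lemma coord_linear2 x z : linear (fun y => coord_tprod x y z).
Proof.
move=> c y y'; apply: coordP => -[i|t1 t2 t3]; rewrite !coordE ?mulr0 ?addr0 //.
all: by rewrite /det2 /det3 ?coordE; ring.
Qed.

Lemma coord_linear3 x y : linear (coord_tprod x y).
Proof.
move=> c z z'; apply: coordP => -[i|t1 t2 t3]; rewrite !coordE ?mulr0 ?addr0 //.
all: by rewrite /det2 /det3 ?coordE; ring.
Qed.

HB.instance Definition _ := Lmodule_isTernary.Build C
  coord_linear1 coord_linear2 coord_linear3.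

Lemma outer_tprod (x y z : C) t : outer [tp x, y, z] t =
  if t is TMul t1 t2 t3 then
    outer x t1 * det2 (inner y) (inner z) t2 t3 else 0.
Proof. by []. Qed.

Lemma inner_tprod (x y z : C) t : inner [tp x, y, z] t =
  if t is TMul t1 t2 t3 then
    det3 (inner x) (inner y) (inner z) t1 t2 t3 else 0.
Proof. by []. Qed.

Lemma coord_alt23 (x y z : C) : [tp x, y, z] + [tp x, z, y] = 0.
Proof.
apply: coordP => -[i|t1 t2 t3].
all: rewrite ?outerD ?innerD ?outer_tprod ?inner_tprod ?addr0 //.
all: by rewrite /det2 /det3 [RHS](_ : _ = 0) //; ring.
Qed.

(** A second argument enters a product only through its inner function. That of the sum [u] adds a
    3x3 determinant to the one with two rows exchanged, hence is zero. *)
Lemma coord_alt_inner (v w x y z : C) :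
  [tp v, [tp w, x, y], z] + [tp v, [tp x, w, y], z] = 0.
Proof.
rewrite -tprodD2; set u := _ + _.
have u0 t : inner u t = 0.
  rewrite innerD !inner_tprod; case: t => [i|t1 t2 t3]; first by rewrite addr0.
  by rewrite /det3; ring.
apply: coordP => -[i|t1 t2 t3] //; rewrite ?outer_tprod ?inner_tprod.
all: by rewrite /det2 /det3 !u0 ?(mul0r, mulr0, subr0, addr0).
Qed.

HB.instance Definition _ := Ternary_isPATA.Build C coord_alt23 coord_alt_inner.

Definition coord_var (i : 'I_n) : C :=
  (fun t => (t == TVar i)%:R, fun t => (t == TVar i)%:R).

Lemma tmon_evalM (P : ternaryType) (v : 'I_n -> P) t1 t2 t3 :
  tmon_eval v (TMul t1 t2 t3) =
  [tp tmon_eval v t1, tmon_eval v t2, tmon_eval v t3].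
Proof. by []. Qed.

(** Both triples of entries are strictly increasing. So a nontrivial permutation of one cannot equal
    the other, and only the diagonal term of the determinant survives. *)
Lemma coord_evalA (t s : mon) : canA t -> canA s ->
  inner (tmon_eval coord_var t) s = (s == t)%:R.
Proof.
elim: t s => [i|t1 h1 t2 h2 t3 h3] [j|s1 s2 s3] // ct cs.
case/and5P: ct => c1 c2 c3 lt12 lt23; case/and5P: cs => d1 d2 d3 ls12 ls23.
have lt13 := tlt_trans lt12 lt23; have ls13 := tlt_trans ls12 ls23.
have K i j k : (i == t1) && (j == t2) && (k == t3) = false ->
    ((i == t1)%:R * (j == t2)%:R * (k == t3)%:R : rat) = 0.
  by rewrite -!natrM !mulnb => ->.
rewrite tmon_evalM inner_tprod /det3 !h1 ?h2 ?h3 //.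
have -> : (TMul s1 s2 s3 == TMul t1 t2 t3) =
    (s1 == t1) && (s2 == t2) && (s3 == t3) by rewrite -!teqE /= andbA.
rewrite -!mulnb !natrM.
rewrite (K s1 s3 s2) ?(K s2 s1 s3) ?(K s2 s3 s1) ?(K s3 s1 s2) ?(K s3 s2 s1).
  by rewrite !(subr0, addr0).
all: apply/negP => /andP[/andP[/eqP e1 /eqP e2] /eqP e3].
all: move: ls12 ls13 ls23; rewrite e1 e2 e3 => l1 l2 l3.
all: move: (tlt_asym lt12) (tlt_asym lt13) (tlt_asym lt23).
all: by rewrite ?l1 ?l2 ?l3.
Qed.

Lemma coord_evalO (t s : mon) : canO t -> canO s ->
  outer (tmon_eval coord_var t) s = (s == t)%:R.
Proof.
elim: t s => [i|t1 h1 t2 _ t3 _] [j|s1 s2 s3] // ct cs.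
case/and4P: ct => c1 c2 c3 lt23; case/and4P: cs => d1 d2 d3 ls23.
rewrite tmon_evalM outer_tprod /det2 h1 // !coord_evalA //.
have -> : (s3 == t2)%:R * (s2 == t3)%:R = 0 :> rat.
  rewrite -natrM mulnb; case: eqP => // e1; case: eqP => // e2.
  by move: ls23; rewrite e1 e2 tlt_asym.
by rewrite subr0 -!natrM !mulnb -!teqE.
Qed.

End Coordinates.

(** * Expansion of the partially alternating sum into words *)

Section SignedSums.
Variable V : lmodType rat.

Definition ssum T (F : T -> V) (L : seq (bool * T)) : V :=
  \sum_(p <- L) (-1) ^+ p.1 *: F p.2.

Lemma ssum_cat T (F : T -> V) L1 L2 : ssum F (L1 ++ L2) = ssum F L1 + ssum F L2.
Proof. exact: big_cat. Qed.

Definition negs T (L : seq (bool * T)) := [seq (~~ p.1, p.2) | p <- L].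

Lemma ssum_negs T (F : T -> V) L : ssum F (negs L) = - ssum F L.
Proof.
rewrite /ssum big_map -sumrN; apply: eq_bigr => p _ /=.
by rewrite signrN scaleNr.
Qed.

Lemma eq_ssum T (F G : T -> V) L : F =1 G -> ssum F L = ssum G L.
Proof. by move=> e; apply: eq_bigr => p _; rewrite e. Qed.

Definition pairs_with T U S (h : T -> U -> S) (L : seq (bool * T))
    (M : seq (bool * U)) : seq (bool * S) :=
  [seq (p.1 (+) q.1, h p.2 q.2) | p <- L, q <- M].

Lemma ssum_pairs T U S (h : T -> U -> S) (F : S -> V) L M :
  ssum F (pairs_with h L M) = ssum (fun x => ssum (fun y => F (h x y)) M) L.
Proof.
rewrite /ssum big_allpairs_dep; apply: eq_bigr => p _; rewrite scaler_sumr.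
by apply: eq_bigr => q _ /=; rewrite signr_addb scalerA.
Qed.

End SignedSums.

Lemma linear_ssum (V W : lmodType rat) (f : V -> W) T (F : T -> V) L :
  linear f -> f (ssum F L) = ssum (fun x => f (F x)) L.
Proof.
move=> lf.
pose g : {linear V -> W} := HB.pack f (GRing.isLinear.Build _ _ _ _ f lf).
rewrite -[f]/(g : _ -> _) linear_sum; apply: eq_bigr => p _.
by rewrite linearZ.
Qed.

Lemma ssum_linear (V W : lmodType rat) T (F : T -> V -> W) L :
  (forall x, linear (F x)) -> linear (fun v => ssum (F^~ v) L).
Proof.
move=> lF c u v; rewrite /ssum scaler_sumr -big_split /=.
by apply: eq_bigr => p _; rewrite lF scalerDr !scalerA mulrC.
Qed.

Section Expansion.
Variable n : nat.
Local Notation letter := 'I_n.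
(* [(l, x, r)] stands for the word [l x r] with centre [x], that is for
   [l |- (x -| r)]. *)
Definition mword : Type := (seq letter * letter * seq letter)%type.

Definition cross := pairs_with (fun u w : seq letter => u ++ w).

Definition rmul := pairs_with (fun (m : mword) (w : seq letter) =>
  ((m.1.1, m.1.2, m.2 ++ w) : mword)).

Definition lmul := pairs_with (fun (m : mword) (w : seq letter) =>
  ((w ++ m.1.1, m.1.2, m.2) : mword)).

(** An inner argument occurs only to the right of [⊣] or to the left of [⊢]. There the bar axioms
    forget its centre, so its words carry none. *)
Fixpoint expA (t : tmon letter) : seq (bool * seq letter) :=
  match t with
  | TVar i => [:: (false, [:: i])]
  | TMul t1 t2 t3 =>
      let a := expA t1 in let b := expA t2 in let c := expA t3 in
      cross (cross a b) c ++ negs (cross (cross a c) b) ++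
      negs (cross (cross b a) c) ++ cross (cross c a) b ++
      cross (cross b c) a ++ negs (cross (cross c b) a)
  end.

Fixpoint expO (t : tmon letter) : seq (bool * mword) :=
  match t with
  | TVar i => [:: (false, ([::], i, [::]))]
  | TMul t1 t2 t3 =>
      let a := expO t1 in let b := expA t2 in let c := expA t3 in
      rmul (rmul a b) c ++ negs (rmul (rmul a c) b) ++
      negs (rmul (lmul a b) c) ++ rmul (lmul a c) b ++
      lmul (lmul a c) b ++ negs (lmul (lmul a b) c)
  end.

Variables (D : dialgebraType) (v : letter -> D).

Definition ract (y : D) (w : seq letter) : D := foldl (fun z i => z ⊣ v i) y w.
Definition lact (w : seq letter) (y : D) : D := foldr (fun i z => v i ⊢ z) y w.
Definition mword_eval (m : mword) : D := lact m.1.1 (ract (v m.1.2) m.2).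

Lemma ract_linear w : linear (ract^~ w).
Proof.
elim/last_ind: w => [|w i h] c y z //=; rewrite /ract !foldl_rcons.
by rewrite -!/(ract _ w) h dleft_linearl.
Qed.

Lemma lact_linear w : linear (lact w).
Proof. by elim: w => [|i w h] c y z //=; rewrite h dright_linearr. Qed.

Lemma ract_cat y u w : ract y (u ++ w) = ract (ract y u) w.
Proof. exact: foldl_cat. Qed.

Lemma lact_cat y u w : lact (u ++ w) y = lact u (lact w y).
Proof. exact: foldr_cat. Qed.

Lemma lact_dleft w y z : lact w y ⊣ z = lact w (y ⊣ z).
Proof. by elim: w => //= i w h; rewrite drightleftA h. Qed.

Lemma lact_ract u y w : ract (lact u y) w = lact u (ract y w).
Proof. by elim: w y => //= i w h y; rewrite lact_dleft h. Qed.

Lemma dleft_pats (y a b c : D) : y ⊣ pats a b c =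
  (y ⊣ a ⊣ b ⊣ c) - (y ⊣ a ⊣ c ⊣ b) - (y ⊣ b ⊣ a ⊣ c) + (y ⊣ c ⊣ a ⊣ b)
  + (y ⊣ b ⊣ c ⊣ a) - (y ⊣ c ⊣ b ⊣ a).
Proof.
by rewrite /pats !(dleftDr, dleftNr) ?(=^~ dbar_right, =^~ dleftA).
Qed.

Lemma dright_pats (y a b c : D) : pats a b c ⊢ y =
  (a ⊢ (b ⊢ (c ⊢ y))) - (a ⊢ (c ⊢ (b ⊢ y))) - (b ⊢ (a ⊢ (c ⊢ y)))
  + (c ⊢ (a ⊢ (b ⊢ y))) + (b ⊢ (c ⊢ (a ⊢ y))) - (c ⊢ (b ⊢ (a ⊢ y))).
Proof.
by rewrite /pats !(drightDl, drightNl) ?(dbar_left, drightA).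
Qed.

Definition ractS L y := ssum (ract y) L.
Definition lactS L y := ssum (lact^~ y) L.

Lemma ractS_linear L : linear (ractS L).
Proof.
by apply: (ssum_linear (F := fun w y => ract y w)) => w; exact: ract_linear.
Qed.

Lemma lactS_linear L : linear (lactS L).
Proof. by apply: (ssum_linear (F := lact)) => w; exact: lact_linear. Qed.

Lemma ractS_cross L M y : ractS (cross L M) y = ractS M (ractS L y).
Proof.
rewrite (linear_ssum _ _ (ractS_linear M)) /ractS ssum_pairs.
by apply: eq_ssum => u; apply: eq_ssum => w; rewrite ract_cat.
Qed.

Lemma lactS_cross L M y : lactS (cross L M) y = lactS L (lactS M y).
Proof.
rewrite /lactS ssum_pairs; apply: eq_ssum => u.
rewrite (linear_ssum _ _ (lact_linear u)).
by apply: eq_ssum => w; rewrite lact_cat.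
Qed.

Lemma ssum_rmul L M :
  ssum mword_eval (rmul L M) = ractS M (ssum mword_eval L).
Proof.
rewrite (linear_ssum _ _ (ractS_linear M)) ssum_pairs.
apply: eq_ssum => m; apply: eq_ssum => w.
by rewrite /mword_eval /= ract_cat lact_ract.
Qed.

Lemma ssum_lmul L M :
  ssum mword_eval (lmul L M) = lactS M (ssum mword_eval L).
Proof.
rewrite (linear_ssum _ _ (lactS_linear M)) ssum_pairs.
apply: eq_ssum => m; apply: eq_ssum => w.
by rewrite /mword_eval /= lact_cat.
Qed.

Fixpoint pats_eval (t : tmon letter) : D :=
  match t with
  | TVar i => v i
  | TMul t1 t2 t3 => pats (pats_eval t1) (pats_eval t2) (pats_eval t3)
  end.

Lemma tmon_eval_pats t : tmon_eval (v : letter -> pats_of D) t = pats_eval t.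
Proof. by elim: t => //= t1 -> t2 -> t3 ->. Qed.

(** Words without centre have no value in [D]; they only act on it from either side. The two actions
    are therefore what the expansion of an inner argument describes. *)
Lemma expA_correct t : (forall y, y ⊣ pats_eval t = ractS (expA t) y) /\
  (forall y, pats_eval t ⊢ y = lactS (expA t) y).
Proof.
elim: t => [i|t1 [r1 l1] t2 [r2 l2] t3 [r3 l3]].
  by split=> y; rewrite /ractS /lactS /ssum big_seq1 scale1r.
split=> y /=; rewrite ?dleft_pats ?dright_pats !(r1, r2, r3, l1, l2, l3).
  rewrite [RHS]/ractS !ssum_cat !ssum_negs -!/(ractS _ _).
  by rewrite !ractS_cross !addrA.
rewrite [RHS]/lactS !ssum_cat !ssum_negs -!/(lactS _ _).
by rewrite !lactS_cross !addrA.
Qed.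

Lemma expO_correct t : pats_eval t = ssum mword_eval (expO t).
Proof.
elim: t => [i|t1 h1 t2 _ t3 _]; first by rewrite /ssum big_seq1 scale1r.
rewrite [LHS]/= /pats.
have [r2 l2] := expA_correct t2; have [r3 l3] := expA_correct t3.
rewrite !drightA !(r2, r3, l2, l3) h1 /= !ssum_cat !ssum_negs.
by rewrite !(ssum_rmul, ssum_lmul) !addrA.
Qed.

End Expansion.

(** * A dialgebra with independent words *)

(** Integer multiples pass through a product by additivity alone, and clearing the denominator of
    [c] reduces to them. *)
Lemma rat_scalerAr (A : lalgType rat) c (x y : A) : x * (c *: y) = c *: (x * y).
Proof.
have d0 : (denq c)%:~R != 0 :> rat by rewrite intr_eq0 denq_neq0.
have e : (denq c)%:~R * c = (numq c)%:~R.
  by rewrite mulrC -{1}[c]divq_num_den divfK.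
apply: (can_inj (scalerK d0)).
by rewrite scaler_int -mulrzAr -scaler_int !scalerA e !scaler_int mulrzAr.
Qed.

(* The dialgebra [A * A] of an associative algebra [A]: the second component
   forgets the centre, the first one is the bimodule containing it. *)
Definition bimod_dialg (A : lalgType rat) : Type := (A * A)%type.

Section BimoduleDialgebra.
Variable A : lalgType rat.
Local Notation D := (bimod_dialg A).
HB.instance Definition _ := GRing.Lmodule.on D.
Implicit Types x y z : D.

Definition bimod_left x y : D := (x.1 * y.2, x.2 * y.2).
Definition bimod_right x y : D := (x.2 * y.1, x.2 * y.2).

Let prodP (x y : D) : x.1 = y.1 -> x.2 = y.2 -> x = y.
Proof. by case: x y => [? ?] [? ?] /= -> ->. Qed.

Lemma bimod_left_linearl y : linear (bimod_left^~ y).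
Proof. by move=> c x x'; apply: prodP; rewrite /= mulrDl scalerAl. Qed.
Lemma bimod_left_linearr x : linear (bimod_left x).
Proof. by move=> c y y'; apply: prodP; rewrite /= mulrDr rat_scalerAr. Qed.
Lemma bimod_right_linearl y : linear (bimod_right^~ y).
Proof. by move=> c x x'; apply: prodP; rewrite /= mulrDl scalerAl. Qed.
Lemma bimod_right_linearr x : linear (bimod_right x).
Proof. by move=> c y y'; apply: prodP; rewrite /= mulrDr rat_scalerAr. Qed.
Lemma bimod_leftA x y z :
  bimod_left (bimod_left x y) z = bimod_left x (bimod_left y z).
Proof. by apply: prodP; rewrite /= mulrA. Qed.
Lemma bimod_rightA x y z :
  bimod_right (bimod_right x y) z = bimod_right x (bimod_right y z).
Proof. by apply: prodP; rewrite /= mulrA. Qed.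
Lemma bimod_rightleftA x y z :
  bimod_left (bimod_right x y) z = bimod_right x (bimod_left y z).
Proof. by apply: prodP; rewrite /= mulrA. Qed.

HB.instance Definition _ := Lmodule_isDialgebra.Build D
  bimod_left_linearl bimod_left_linearr bimod_right_linearl
  bimod_right_linearr bimod_leftA bimod_rightA bimod_rightleftA
  (fun _ _ _ => erefl) (fun _ _ _ => erefl).

End BimoduleDialgebra.

Section WordCoefficients.
Variable n : nat.
Local Notation letter := 'I_n.
(* The free associative algebra on two copies of the letters; the letters of the
   copy [true] serve as centres. *)
Local Notation F := {malg rat[{fmonom (bool * letter)%type}]}.

Definition word (w : seq (bool * letter)) : F := << FMonom w >>.

Lemma wordM u w : word u * word w = word (u ++ w).
Proof. by rewrite /word malgM_def fgmulUU mulr1 [mmul _ _]fmmulE. Qed.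

Definition centred (m : mword n) : seq (bool * letter) :=
  map (pair false) m.1.1 ++ (true, m.1.2) :: map (pair false) m.2.

(** The only letter of the copy [true] marks the centre. *)
Lemma centred_inj : injective centred.
Proof.
have inj : injective (pair false : letter -> bool * letter) by move=> x y [].
move=> [[l x] r] [[l' x'] r']; rewrite /centred /=.
elim: l l' => [|i l h] [|j l'] //= []; first by move=> -> /(inj_map inj) ->.
by move=> -> /h [-> -> ->].
Qed.

Definition word_var (x : letter) : bimod_dialg F :=
  (word [:: (true, x)], word [:: (false, x)]).

Lemma mword_eval_word m : (mword_eval word_var m).1 = word (centred m).
Proof.
have ractE (y : bimod_dialg F) u w : y.1 = word u ->
    (ract word_var y w).1 = word (u ++ map (pair false) w).
  elim: w y u => [|i w h] y u e /=; first by rewrite cats0.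
  by rewrite (h _ (u ++ [:: (false, i)])) /= ?e ?wordM // -catA.
have lactE (y : bimod_dialg F) u w : y.1 = word u ->
    (lact word_var w y).1 = word (map (pair false) w ++ u).
  by move=> e; elim: w => //= i w ->; rewrite wordM.
by rewrite /mword_eval; apply: lactE; apply: (ractE _ [:: (true, m.1.2)]).
Qed.

Definition mcount (L : seq (bool * mword n)) (m : mword n) : rat :=
  ssum (fun m' => ((m' == m)%:R : rat^o)) L.

Lemma pats_eval_coef (t : tmon letter) m :
  (pats_eval word_var t).1@_(FMonom (centred m)) = mcount (expO t) m.
Proof.
rewrite expO_correct /mcount /ssum.
rewrite (big_morph (fun x => x.1) (id1 := 0) (op1 := +%R)) //.
rewrite raddf_sum; apply: eq_bigr => p _ /=.
rewrite [LHS]mcoeffZ mword_eval_word mcoeffU1; congr (_ * _%:R).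
by rewrite -val_eqE /= (inj_eq centred_inj).
Qed.

End WordCoefficients.

(** All heavy computations run on binary integers; [ratz] carries their results to the rationals. *)
Definition ratz (z : Z) : rat := (int_of_Z z)%:~R.

Lemma ratzD x y : ratz (Z.add x y) = ratz x + ratz y.
Proof. by rewrite /ratz -intrD -rmorphD. Qed.

Lemma ratzM x y : ratz (Z.mul x y) = ratz x * ratz y.
Proof. by rewrite /ratz -intrM -rmorphM. Qed.

Lemma ratzN x : ratz (Z.opp x) = - ratz x.
Proof. by rewrite /ratz -mulrNz -rmorphN. Qed.

Lemma ratz_eq0 x : (ratz x == 0) = Z.eqb x Z0.
Proof.
rewrite /ratz intr_eq0 -(rmorph0 int_of_Z) (inj_eq (can_inj int_of_ZK)).
by apply/eqP/idP => /Z.eqb_eq.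
Qed.

(** * Sparse linear systems over the integers *)

(* [(i, a)] stands for the term [a * c_i]. *)
Definition zrow := seq (Z * Z).

Definition zscale (a : Z) (p : zrow) : zrow :=
  [seq (t.1, Z.mul a t.2) | t <- p].

(* [a * p + b * q], for rows sorted by index *)
Fixpoint zcomb (a : Z) (p : zrow) (b : Z) : zrow -> zrow :=
  fix aux (q : zrow) : zrow :=
    match p, q with
    | [::], _ => zscale b q
    | _, [::] => zscale a p
    | (i, x) :: p', (j, y) :: q' =>
        if Z.ltb i j then (i, Z.mul a x) :: zcomb a p' b q
        else if Z.ltb j i then (j, Z.mul b y) :: aux q'
        else
          let z := Z.add (Z.mul a x) (Z.mul b y) in
          if Z.eqb z Z0 then zcomb a p' b q' else (i, z) :: zcomb a p' b q'
    end.

Definition leads (k : Z) (p : zrow) : bool :=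
  if p is (i, _) :: _ then Z.eqb i k else false.

Definition zlead (p : zrow) : Z := if p is (_, a) :: _ then a else Z0.

(** A leading coefficient of absolute value 1 is preferred, to limit the growth of the coefficients
    in this fraction-free elimination. *)
Definition pivot (L : seq zrow) : zrow :=
  if [seq p <- L | Z.eqb (Z.abs (zlead p)) Z.one] is p :: _ then p
  else head [::] L.

(* Gaussian elimination of the unknowns [k, k + 1, ..., k + d - 1]; the answer
   is true only if the system forces all of them to be zero. *)
Fixpoint forces_zero (d : nat) (k : Z) (E : seq zrow) : bool :=
  if d is d'.+1 then
    let L := [seq p <- E | leads k p] in
    if pivot L is (i, a) :: t then
      [&& Z.eqb i k, ~~ Z.eqb a Z0,
          all (fun u => Z.ltb k u.1 && Z.ltb u.1 (Z.add k (Z.of_nat d))) t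
        & forces_zero d' (Z.succ k)
            ([seq zcomb a p (Z.opp (zlead p)) ((i, a) :: t) | p <- L] ++
             [seq p <- E | ~~ leads k p])]
    else false
  else true.

Section Soundness.
Variable c : Z -> rat.

Definition zdot (p : zrow) : rat := \sum_(t <- p) ratz t.2 * c t.1.

Lemma zdot_cons i a p : zdot ((i, a) :: p) = ratz a * c i + zdot p.
Proof. exact: big_cons. Qed.

Lemma zdot_scale a p : zdot (zscale a p) = ratz a * zdot p.
Proof.
rewrite /zdot big_map mulr_sumr; apply: eq_bigr => t _.
by rewrite ratzM mulrA.
Qed.

Lemma zdot_comb a p b q :
  zdot (zcomb a p b q) = ratz a * zdot p + ratz b * zdot q.
Proof.
have nil0 : zdot [::] = 0 by exact: big_nil.
elim: p q => [|[i x] p hp] q.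
  have -> : zcomb a [::] b q = zscale b q by case: q.
  by rewrite zdot_scale nil0 mulr0 add0r.
elim: q => [|[j y] q hq].
  have -> : zcomb a ((i, x) :: p) b [::] = zscale a ((i, x) :: p) by [].
  by rewrite zdot_scale nil0 mulr0 addr0.
rewrite [zcomb _ _ _ _]/=.
case: ifP => [_|/Z.ltb_ge ji].
  by rewrite !zdot_cons hp ?zdot_cons ratzM; ring.
case: ifP => [_|/Z.ltb_ge ij].
  by rewrite !zdot_cons hq ?zdot_cons ratzM; ring.
have <- : i = j by lia.
have e :
    ratz (Z.add (Z.mul a x) (Z.mul b y)) = ratz a * ratz x + ratz b * ratz y.
  by rewrite ratzD !ratzM.
case: ifP => z0; rewrite ?zdot_cons hp.
  move: z0; rewrite -ratz_eq0 e => /eqP z0.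
  rewrite [RHS](_ : _ = ratz a * zdot p + ratz b * zdot q +
    (ratz a * ratz x + ratz b * ratz y) * c i); last by ring.
  by rewrite z0 mul0r addr0.
by rewrite e; ring.
Qed.

Lemma pivot_mem L : pivot L = [::] \/ pivot L \in L.
Proof.
rewrite /pivot; case e: [seq _ <- L | _] => [|p s].
  by case: L {e} => [|p L] /=; [left|right; rewrite mem_head].
by right; have: p \in p :: s := mem_head _ _; rewrite -e mem_filter => /andP[].
Qed.

(** The rows passed to the recursive call are rows of [E] or combinations of two of them, so [c]
    still satisfies them and the unknowns after [k] vanish by induction. The remaining indices of
    the pivot row were checked to be among those, so its nonzero coefficient gives [c k = 0]. Only
    this is needed: neither the order in the rows nor the success of a cancellation enters. *)
Lemma forces_zeroP d k E : forces_zero d k E ->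
  (forall p, p \in E -> zdot p = 0) ->
  forall j, (Z.le k j /\ Z.lt j (Z.add k (Z.of_nat d))) -> c j = 0.
Proof.
elim: d k E => [|d IH] k E; first by move=> _ _ j; lia.
rewrite [forces_zero _ _ _]/=; case ep: pivot => [|[i a] t] //.
have pE : (i, a) :: t \in E.
  have [|] := pivot_mem [seq p <- E | leads k p]; rewrite ep //.
  by rewrite mem_filter => /andP[].
case/and4P=> /Z.eqb_eq ik; rewrite {}ik in pE * => a0 /allP tP FZ E0.
have next j : (Z.lt k j /\ Z.lt j (Z.add k (Z.of_nat d.+1))) -> c j = 0.
  move=> kj; apply: (IH (Z.succ k) _ FZ); last lia.
  move=> p; rewrite mem_cat => /orP[/mapP[q qL ->]|]; last first.
    by rewrite mem_filter => /andP[_ /E0].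
  rewrite zdot_comb (E0 _ pE) E0 ?mulr0 ?addr0 //.
  by move: qL; rewrite mem_filter => /andP[].
move=> j [kj jd]; have [jk|jk] := Z.eq_dec j k; last by apply: next; lia.
have := E0 _ pE; rewrite zdot_cons jk.
have -> : zdot t = 0.
  apply: big1_seq => u /= /tP /andP[/Z.ltb_lt ku /Z.ltb_lt ud].
  by rewrite next ?mulr0 //; lia.
by rewrite addr0 => /eqP; rewrite mulf_eq0 ratz_eq0 (negbTE a0) => /eqP.
Qed.

End Soundness.

(** * The linear system *)

Section Words.
Variable n : nat.

(** Position of the centre, centre, then the other letters. A word of degree 7 gives eight numbers,
    all below 7, which fixes the depth 8 and the branching [iota 0 7] of the prefix trees. *)
Definition key (m : mword n) : seq nat :=
  size m.1.1 :: val m.1.2 :: map val (m.1.1 ++ m.2).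

Definition keyed (L : seq (bool * mword n)) : seq (bool * seq nat) :=
  [seq (p.1, key p.2) | p <- L].

End Words.

(* The terms whose word starts with the letter [a], with this letter deleted. *)
Definition strip (a : nat) (L : seq (bool * seq nat)) : seq (bool * seq nat) :=
  pmap (fun p => if p.2 is b :: k then
                   if eqn a b then Some (p.1, k) else None else None) L.

Definition strip_all (a : nat) (T : seq (Z * seq (bool * seq nat))) :=
  pmap (fun u => if strip a u.2 is p :: L then Some (u.1, p :: L) else None) T.

Fixpoint sign_total (L : seq (bool * seq nat)) : Z :=
  match L with
  | (b, [::]) :: L' =>
      Z.add (if b then Zneg xH else Zpos xH) (sign_total L')
  | _ :: L' => sign_total L'
  | [::] => Z0
  end.

Definition total_row (T : seq (Z * seq (bool * seq nat))) : zrow :=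
  [seq u <- [seq (u.1, sign_total u.2) | u <- T] | ~~ Z.eqb u.2 Z0].

(* The rows of the keys in [ks], all of length [d], computed along the prefix
   tree of [ks]. *)
Fixpoint key_rows (d : nat) (ks : seq (seq nat))
    (T : seq (Z * seq (bool * seq nat))) : seq zrow :=
  if ks is [::] then [::] else
  if d is d'.+1 then
    flatten [seq key_rows d' [seq behead k | k <- ks & eqn a (head 7 k)]
                             (strip_all a T) | a <- iota 0 7]
  else [:: total_row T].

Fixpoint zindex T (i : Z) (s : seq T) : seq (Z * T) :=
  if s is x :: s' then (i, x) :: zindex (Z.succ i) s' else [::].

Local Notation V := (fun i => TVar (i : 'I_5)).

(** The five bracketings of degree 7 compatible with sorting, in which composite arguments precede
    variables. *)
Definition shapes (s : seq 'I_5) : seq (tmon 'I_5) :=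
  if s is [:: x1; x2; x3; x4; x5; x6; x7] then
  [:: TMul (V x1) (TMul (V x2) (V x3) (V x4)) (TMul (V x5) (V x6) (V x7));
      TMul (TMul (V x1) (TMul (V x2) (V x3) (V x4)) (V x5)) (V x6) (V x7);
      TMul (TMul (TMul (V x1) (V x2) (V x3)) (V x4) (V x5)) (V x6) (V x7);
      TMul (TMul (V x1) (V x2) (V x3)) (TMul (V x4) (V x5) (V x6)) (V x7);
      TMul (V x1) (TMul (TMul (V x2) (V x3) (V x4)) (V x5) (V x6)) (V x7)]
  else [::].

Definition content : seq 'I_5 := [:: va; va; vb; vb; vc; vd; ve].

Definition basis22111 : seq (tmon 'I_5) :=
  let P := permutations content in
  flatten [seq [seq t <- [seq nth (TVar va) (shapes s) i | s <- P] | canO t]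
          | i <- iota 0 5].

(** The fixed width [k] restores the leading zeros lost in a number literal. *)
Fixpoint digits (k : nat) (w : N) (acc : seq nat) : seq nat :=
  if k is k'.+1 then
    let (q, r) := N.div_eucl w 10 in digits k' q (N.to_nat r :: acc)
  else acc.

(* [words_xp]: words with centre x and p letters before it, the other six letters
   being written as digits (a = 0, ..., e = 4). *)
Definition words_a0 : seq N := [:: 011234; 011324; 011423; 021134; 021143;
  023114; 023411; 024113; 031124; 031142; 032411; 034112; 041123; 041132;
  042311; 110234; 110324; 110423; 112034; 112304; 112403; 113204; 113402;
  114203; 201134; 203114; 204113; 211034; 211304; 211403; 230114; 230411;
  234110; 240113; 240311; 243110; 301124; 302114; 304112; 311024; 311204;
  311402; 320114; 340112; 340211; 401123; 402113; 403112; 411023; 411203;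
  411302; 420113; 430112; 102431; 103421; 120431; 123104; 132104; 134201;
  140321; 142031; 142103; 143201; 214310; 341021; 021413; 034121; 042131;
  121304; 121403; 131204; 310124; 410123; 012341; 013241]%num.

Definition words_a1 : seq N := [:: 032114; 234110; 340112; 401132; 402311;
  420113; 101324; 102314; 102413; 103412; 123410; 124310; 132410; 134210;
  141230; 142310; 143012; 143210; 314210; 102341; 102431; 103421; 113024;
  120341; 123401; 130421; 132401; 312104; 213401]%num.

Definition words_c0 : seq N := [:: 001134; 110034; 300114; 311004; 400113;
  411003; 001341; 001431; 011340; 011430; 034011; 034110; 043011; 043110;
  100341; 100431; 110340; 110430; 113004; 114003; 134001; 134100; 143001;
  143100; 031041; 011304]%num.

Definition words_c1 : seq N := [:: 040113; 131004; 141003; 001143; 031401;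
  034110; 041301; 101304; 340110; 001314; 013140; 104301; 110304; 301410]%num.

Definition swap_nat (i j x : nat) : nat :=
  if eqn x i then j else if eqn x j then i else x.

(* Words whose equations have rank 328, found by elimination on all the words
   with at most one letter before the centre; those with centre b, d, e are
   obtained from those with centre a, c by exchanging letters. *)
Definition keys22111 : seq (seq nat) :=
  let K p x ws := [seq p :: x :: digits 6 w [::] | w <- ws] in
  let sw i j := map (fun k => head 0 k :: map (swap_nat i j) (behead k)) in
  let A := K 0 0 words_a0 ++ K 1 0 words_a1 in
  let C := K 0 2 words_c0 ++ K 1 2 words_c1 in
  A ++ sw 0 1 A ++ C ++ sw 2 3 C ++ sw 2 4 C.

Definition table22111 : seq (Z * seq (bool * seq nat)) :=
  zindex Z0 [seq keyed (expO t) | t <- basis22111].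

(** The two one-term rows put to zero the coordinates on [pivot1] and [pivot2]. The other rows are
    word equations in the 330 coordinates on [basis22111], numbered by their position there. *)
Definition system22111 : seq zrow :=
  [:: [:: (Zpos 324, Z.one)]; [:: (Zpos 329, Z.one)]] ++
  key_rows 8 keys22111 table22111.

Section KeyRows.

Definition sign_coef (L : seq (bool * seq nat)) (k : seq nat) : rat :=
  \sum_(p <- L | p.2 == k) (-1) ^+ p.1.

Lemma sign_coef_cons b k' L k :
  sign_coef ((b, k') :: L) k = (-1) ^+ b *+ (k' == k) + sign_coef L k.
Proof. by rewrite /sign_coef big_cons; case: eqP => _; rewrite ?add0r. Qed.

Lemma sign_coef_strip a L k : sign_coef (strip a L) k = sign_coef L (a :: k).
Proof.
elim: L => [|[b [|a' k']] L h]; first by rewrite /sign_coef !big_nil.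
  by rewrite sign_coef_cons -h add0r.
rewrite sign_coef_cons eqseq_cons -h /= eqnE [a == a']eq_sym.
by case: (a' == a); rewrite ?sign_coef_cons ?add0r.
Qed.

Lemma sign_totalE L : ratz (sign_total L) = sign_coef L [::].
Proof.
elim: L => [|[b [|a k]] L h]; first by rewrite /sign_coef big_nil.
  by rewrite sign_coef_cons -h [sign_total _]/= ratzD mulr1n; case: b.
by rewrite sign_coef_cons -h /= add0r.
Qed.

Variable c : Z -> rat.
Local Notation table := (seq (Z * seq (bool * seq nat))).

Lemma sum_strip_all a (T : table) k :
  \sum_(u <- strip_all a T) c u.1 * sign_coef u.2 k =
  \sum_(u <- T) c u.1 * sign_coef u.2 (a :: k).
Proof.
elim: T => [|[i L] T h]; first by rewrite !big_nil.
rewrite big_cons -h /= -sign_coef_strip.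
case: strip => [|p L'] /=; last by rewrite big_cons.
by rewrite /sign_coef big_nil mulr0 add0r.
Qed.

Lemma zdot_total_row (T : table) :
  zdot c (total_row T) = \sum_(u <- T) c u.1 * sign_coef u.2 [::].
Proof.
rewrite /zdot /total_row big_filter big_mkcond big_map.
apply: eq_bigr => u _ /=.
rewrite -sign_totalE mulrC -ratz_eq0; case: eqP => [->|//].
by rewrite mulr0.
Qed.

(** Deleting a first letter turns the equation of [a :: k] for [T] into that of [k] for the stripped
    table. Hence every row produced is a word equation, whatever the list [ks]. *)
Lemma zdot_key_rows d ks (T : table) :
  (forall k, \sum_(u <- T) c u.1 * sign_coef u.2 k = 0) ->
  forall p, p \in key_rows d ks T -> zdot c p = 0.
Proof.
elim: d ks T => [|d IH] [|k ks] T T0 p //.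
  by rewrite inE => /eqP ->; rewrite zdot_total_row.
case/flatten_mapP=> a _; apply: IH => k'.
by rewrite sum_strip_all.
Qed.

Lemma sum_zindex T S (x0 : T) (s : seq T) (h : T -> S) (k : Z) (d : T -> rat)
    (G : S -> rat) :
  (forall i, (i < size s)%N -> c (Z.add k (Z.of_nat i)) = d (nth x0 s i)) ->
  \sum_(u <- zindex k (map h s)) c u.1 * G u.2 = \sum_(t <- s) d t * G (h t).
Proof.
elim: s k => [|t s IH] k e; first by rewrite !big_nil.
rewrite /= !big_cons /=; congr (_ * _ + _).
  by rewrite -(e 0%N) // Z.add_0_r.
apply: IH => i si; rewrite -(e i.+1) //; congr (c _); lia.
Qed.

End KeyRows.

(** * Formal cancellation of integer combinations of words *)

Section Cancellation.

Definition zstrip (a : nat) (L : seq (Z * seq nat)) : seq (Z * seq nat) :=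
  pmap (fun p => if p.2 is b :: k then
                   if eqn a b then Some (p.1, k) else None else None) L.

Definition ztotal (L : seq (Z * seq nat)) : Z :=
  foldr (fun p z => Z.add p.1 z) Z0 L.

(** Equal words are gathered along a prefix tree instead of being compared pairwise. *)
Fixpoint cancels (d : nat) (L : seq (Z * seq nat)) : bool :=
  if L is [::] then true else
  if d is d'.+1 then all (fun a => cancels d' (zstrip a L)) (iota 0 7)
  else Z.eqb (ztotal L) Z0.

(** This guarantees that no term is lost when the list is split by first entry over [iota 0 7], and
    that the leaves of the tree hold empty keys. *)
Definition keys_of_size (d : nat) (L : seq (Z * seq nat)) : bool :=
  all (fun p => eqn (size p.2) d && all (fun a => (a < 7)%N) p.2) L.

Variable W : lmodType rat.

Definition zsum T (F : T -> W) (L : seq (Z * T)) : W :=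
  \sum_(p <- L) ratz p.1 *: F p.2.

Lemma keys_of_size_strip a d L :
  keys_of_size d.+1 L -> keys_of_size d (zstrip a L).
Proof.
elim: L => [|[z [|b k]] L h] //= /andP[/andP[/= sk /andP[_ lk]] /h {}h].
by case: eqn => //; rewrite /keys_of_size /= sk lk.
Qed.

Lemma zsum_strip (F : seq nat -> W) d L : keys_of_size d.+1 L ->
  zsum F L = \sum_(a <- iota 0 7) zsum (fun k => F (a :: k)) (zstrip a L).
Proof.
elim: L => [|[z [|b k]] L h] // => [_|].
  by rewrite /zsum big_nil big1 // => a _; rewrite big_nil.
case/andP=> /andP[_ /andP[b7 _]] /h {}h; rewrite /zsum big_cons -/(zsum F L) h.
have mb : b \in iota 0 7 by rewrite mem_iota.
have -> : \sum_(a <- iota 0 7)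
      zsum (fun k => F (a :: k)) (zstrip a ((z, b :: k) :: L)) =
    \sum_(a <- iota 0 7) ((if a == b then ratz z *: F (b :: k) else 0) +
                          zsum (fun k => F (a :: k)) (zstrip a L)).
  apply: eq_bigr => a _ /=; rewrite eqnE; case: eqP => [->|_] /=.
    by rewrite /zsum big_cons.
  by rewrite add0r.
rewrite big_split -big_mkcond -big_filter.
by rewrite filter_pred1_uniq ?iota_uniq // big_seq1.
Qed.

(** [F] stays arbitrary because each descent absorbs the first letter into it. *)
Lemma cancelsP d L : keys_of_size d L -> cancels d L ->
  forall F : seq nat -> W, zsum F L = 0.
Proof.
elim: d L => [|d IH] [|p L] kL cL F; rewrite ?/zsum ?big_nil // -/(zsum F _).
  have : ratz (ztotal (p :: L)) = 0 by apply/eqP; rewrite ratz_eq0.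
  suff -> : zsum F (p :: L) = ratz (ztotal (p :: L)) *: F [::].
    by move=> ->; rewrite scale0r.
  elim: (p :: L) kL => [|[z [|a k]] M h] //= kM.
    by rewrite /zsum big_nil scale0r.
  by rewrite /zsum big_cons /= -/(zsum F M) h // ratzD scalerDl.
rewrite (zsum_strip F kL) big_seq big1 // => a /(allP cL) ca.
by rewrite -(IH _ (keys_of_size_strip a kL) ca (fun k => F (a :: k))).
Qed.

End Cancellation.

(** * Sums over the symmetric group *)

Definition letters5 : seq 'I_5 := [:: va; vb; vc; vd; ve].

Definition perm_code (s : 'S_5) : seq 'I_5 := map s letters5.

Fixpoint odd_inversions (l : seq 'I_5) : bool :=
  if l is x :: l' then
    odd (count (fun y : 'I_5 => (y < x)%N) l') (+) odd_inversions l'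
  else false.

Definition swap_positions (x y : nat) (l : seq 'I_5) : seq 'I_5 :=
  [seq nth va l (swap_nat x y i) | i <- iota 0 5].

(** A transposition changes the parity of the number of inversions, verified on all arrangements of
    the five letters. This identifies the computable parity with [odd_perm] by induction on a
    factorization into transpositions. *)
Lemma odd_inversions_swap : all (fun l => all (fun x => all (fun y =>
    eqn x y || (odd_inversions (swap_positions x y l) (+) odd_inversions l))
  (iota 0 5)) (iota 0 5)) (permutations letters5).
Proof. by vm_compute. Qed.

Lemma mem_letters5 (i : 'I_5) : i \in letters5.
Proof. by case: i => -[|[|[|[|[|]]]]]. Qed.

Lemma nth_letters5 (i : 'I_5) : nth va letters5 i = i.
Proof. by apply: val_inj; case: i => -[|[|[|[|[|]]]]]. Qed.

Lemma perm_code_mem s : perm_code s \in permutations letters5.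
Proof.
rewrite mem_permutations; apply: uniq_perm => // [|i].
  by rewrite map_inj_uniq //; exact: perm_inj.
rewrite mem_letters5; apply/mapP; exists (s^-1%g i); first exact: mem_letters5.
by rewrite permKV.
Qed.

Lemma perm_code_inj : injective perm_code.
Proof.
move=> s t /(congr1 (fun l => nth va l)) e; apply/permP => i.
have := congr1 (fun f => f (val i)) e.
by rewrite /perm_code !(nth_map va) ?nth_letters5 // (valP i).
Qed.

Lemma perm_code_tperm x y s :
  perm_code (tperm x y * s)%g = swap_positions x y (perm_code s).
Proof.
rewrite /swap_positions -[iota 0 5]/(map val letters5) -map_comp.
apply: eq_map => i; rewrite permM /= /swap_nat !eqnE !val_eqE.
have nthE j : nth va (perm_code s) (val (j : 'I_5)) = s j.
  by rewrite /perm_code (nth_map va) ?nth_letters5 // (valP j).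
case: tpermP => [->|->|/eqP/negbTE-> /eqP/negbTE->]; rewrite ?eqxx ?nthE //.
by case: (y =P x) => [->|_]; rewrite nthE.
Qed.

Lemma odd_perm_code (s : 'S_5) : odd_perm s = odd_inversions (perm_code s).
Proof.
have [ts -> dts] := prod_tpermP s; elim: ts dts => [_|[x y] ts IH].
  by rewrite big_nil odd_perm1 /= !perm1.
case/andP=> dxy /IH {}IH; rewrite big_cons odd_mul_tperm IH perm_code_tperm.
have nxy : x != y := dxy; rewrite nxy.
set C := perm_code _.
have := allP (allP (allP odd_inversions_swap C (perm_code_mem _)) x _) y _.
rewrite !mem_iota !(valP x) !(valP y) => /(_ isT isT).
rewrite eqnE val_eqE (negbTE nxy) orFb.
by case: odd_inversions; case: odd_inversions.
Qed.

Lemma sum_S5 (W : nmodType) (G : bool -> seq 'I_5 -> W) :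
  \sum_(s : 'S_5) G s (perm_code s) =
  \sum_(l <- permutations letters5) G (odd_inversions l) l.
Proof.
have -> : \sum_(l <- permutations letters5) G (odd_inversions l) l =
    \sum_(l <- map perm_code (enum 'S_5)) G (odd_inversions l) l.
  apply: perm_big; rewrite perm_sym; apply: uniq_perm.
  - by rewrite map_inj_uniq ?enum_uniq //; exact: perm_code_inj.
  - exact: permutations_uniq.
  (* The codes are 5! distinct members of a list of 5! entries, so they exhaust it. *)
  - move=> l; have [] := @uniq_min_size _ (map perm_code (enum 'S_5))
      (permutations letters5) _ _ _; last by move=> _ ->.
    + by rewrite map_inj_uniq ?enum_uniq //; exact: perm_code_inj.
    + by move=> _ /mapP[s _ ->]; exact: perm_code_mem.
    + by rewrite size_map -cardE card_Sn size_permutations.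
rewrite big_map big_enum; apply: eq_bigr => s _.
by rewrite odd_perm_code.
Qed.

(** * The two identities as straightened integer combinations *)

Lemma zsum_cons (W : lmodType rat) T (F : T -> W) z x L :
  zsum F ((z, x) :: L) = ratz z *: F x + zsum F L.
Proof. exact: big_cons. Qed.

Fixpoint zadd (z : Z) (m : tmon 'I_5) (acc : seq (Z * tmon 'I_5)) :=
  match acc with
  | [::] => [:: (z, m)]
  | (y, u) :: acc' =>
      if teq m u then (Z.add z y, u) :: acc' else (y, u) :: zadd z m acc'
  end.

Definition straighten (L : seq (Z * tmon 'I_5)) : seq (Z * tmon 'I_5) :=
  [seq p <- foldr (fun p acc =>
     if nfO p.2 is Some (b, u) then zadd (if b then Z.opp p.1 else p.1) u acc
     else acc) [::] L | ~~ Z.eqb p.1 Z0].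

Lemma zsum_zadd (W : lmodType rat) (F : tmon 'I_5 -> W) z m acc :
  zsum F (zadd z m acc) = ratz z *: F m + zsum F acc.
Proof.
elim: acc => [|[y u] acc h] /=; first by rewrite zsum_cons.
rewrite teqE; case: eqP => [->|_]; rewrite !zsum_cons.
  by rewrite ratzD scalerDl addrA.
by rewrite h addrCA.
Qed.

Lemma zsum_straighten (P : pataType) (v : 'I_5 -> P) L :
  zsum (tmon_eval v) (straighten L) = zsum (tmon_eval v) L.
Proof.
transitivity (zsum (tmon_eval v) (foldr (fun p acc =>
     if nfO p.2 is Some (b, u) then zadd (if b then Z.opp p.1 else p.1) u acc
     else acc) [::] L)).
  rewrite /zsum /straighten big_filter big_mkcond; apply: eq_bigr => p _.
  by rewrite -ratz_eq0; case: eqP => [->|]; rewrite ?scale0r.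
elim: L => [|[z t] L h] //=; rewrite zsum_cons nfO_correct -h.
case: nfO => [[b u]|] /=; last by rewrite scaler0 add0r.
rewrite zsum_zadd scalerA; case: b; rewrite ?mulr1 //.
by rewrite ratzN mulrN1.
Qed.

(** The first identity multiplied by 12, so that 1/4, -1/12, -1/12, -1/6 become 3, -1, -1, -2. *)
Definition terms22111 : seq (Z * tmon 'I_5) :=
  let V i := TVar (i : 'I_5) in
  flatten [seq
    (if l is [:: p; q; r; s; t] then
       let z c := if odd_inversions l then Z.opp c else c in
       [:: (z (Zpos 3),
            TMul (TMul (TMul (V va) (V p) (V q)) (V vb) (V r)) (V s) (V t));
           (z (Zneg 1),
            TMul (TMul (V va) (TMul (V p) (V q) (V r)) (V vb)) (V s) (V t));
           (z (Zneg 1),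
            TMul (TMul (V va) (V p) (V q)) (TMul (V r) (V s) (V t)) (V vb));
           (z (Zneg 2),
            TMul (V va) (TMul (TMul (V p) (V q) (V r)) (V vb) (V s)) (V t))]
     else [::])
  | l <- permutations letters5].

Fixpoint tmap (f : 'I_5 -> 'I_5) (t : tmon 'I_5) : tmon 'I_5 :=
  match t with
  | TVar i => TVar (f i)
  | TMul t1 t2 t3 => TMul (tmap f t1) (tmap f t2) (tmap f t3)
  end.

(** An explicit table for [tperm va vb], suited to evaluation. *)
Definition swap_ab (i : 'I_5) : 'I_5 := nth va [:: vb; va; vc; vd; ve] i.

Definition form1 : seq (Z * tmon 'I_5) := straighten terms22111.
Definition form2 : seq (Z * tmon 'I_5) :=
  straighten [seq (p.1, tmap swap_ab p.2) | p <- terms22111].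

(** * Coordinates on the free PATA *)

Section CoordinateFunctionals.
Variable n : nat.
Local Notation FP := (freePATA 'I_n).
Implicit Types (f : FP) (m t : tmon 'I_n).

(** Well defined on classes because [coord n] is a PATA; on sorted monomials these functionals form
    the dual family. *)
Definition coordO m f : rat := outer (pata_eval (@coord_var n) f) m.

Lemma coordOP m c f h : coordO m (c *: f + h) = c * coordO m f + coordO m h.
Proof. by rewrite /coordO pata_eval_is_linear outerP. Qed.

Lemma coordO0 m : coordO m 0 = 0.
Proof. by have := coordOP m (-1) 0 0; rewrite scaler0 addr0 mulN1r addNr. Qed.

Lemma coordOD m : {morph coordO m : f h / f + h}.
Proof. by move=> f h; have := coordOP m 1 f h; rewrite scale1r mul1r. Qed.

Lemma coordOZ m c f : coordO m (c *: f) = c * coordO m f.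
Proof. by have := coordOP m c f 0; rewrite coordO0 !addr0. Qed.

Lemma tmon_eval_gen t : tmon_eval (@pata_gen 'I_n) t = pata_class << t >>.
Proof.
elim: t => [//|t1 h1 t2 h2 t3 h3] /=.
by rewrite h1 h2 h3 -pata_classM free_tprodU.
Qed.

Lemma pata_eval_tmon (P : pataType) (w : 'I_n -> P) t :
  pata_eval w (tmon_eval (@pata_gen 'I_n) t) = tmon_eval w t.
Proof.
by rewrite tmon_eval_gen pata_eval_class /free_eval lin_extU scale1r.
Qed.

Lemma coordO_mon m t : canO m -> canO t ->
  coordO m (tmon_eval (@pata_gen 'I_n) t) = (m == t)%:R.
Proof. by move=> cm ct; rewrite /coordO pata_eval_tmon coord_evalO. Qed.

Lemma pata_class_expand (g : {malg rat[tmon 'I_n]}) :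
  pata_class g = \sum_(t <- msupp g) g@_t *: tmon_eval (@pata_gen 'I_n) t.
Proof.
rewrite {1}[g]monalgE (big_morph _ (@pata_classD _) (@pata_class0 _)).
by apply: eq_bigr => t _; rewrite malgUZ pata_classZ tmon_eval_gen.
Qed.

Lemma coordO_class (g : {malg rat[tmon 'I_n]}) m :
  (forall t, t \in msupp g -> canO t) -> canO m ->
  coordO m (pata_class g) = g@_m.
Proof.
move=> gc cm; rewrite pata_class_expand (big_morph _ (coordOD m) (coordO0 m)).
transitivity (\sum_(t <- msupp g) if t == m then g@_m else 0).
  rewrite big_seq [RHS]big_seq; apply: eq_bigr => t /gc ct.
  rewrite coordOZ coordO_mon // eq_sym; case: eqP => [->|_]; first exact: mulr1.
  exact: mulr0.
rewrite -big_mkcond -big_filter; have [ms|nms] := boolP (m \in msupp g).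
  by rewrite filter_pred1_uniq ?fset_uniq // big_seq1.
rewrite mcoeff_outdom //; apply: big1_seq => t /=.
by rewrite mem_filter => /andP[/eqP ->]; rewrite (negbTE nms).
Qed.

Lemma straightened7_can t : straightened7 t -> canO t.
Proof.
have E (i j : 'I_n) : (i == j) = eqn i j by rewrite eqnE val_eqE.
rewrite /straightened7.
repeat match goal with
  |- context [match ?t with TVar _ => _ | TMul _ _ _ => _ end] =>
    is_var t; case: t => [?|? ? ?] //
end.
all: rewrite ?E /= ?andbT.
all: repeat match goal with |- is_true (_ && _) -> _ => case/andP => -> end.
all: by move=> ->.
Qed.

(** Straightened monomials are sorted, so the coordinates of [f] recover every coefficient of the
    form. *)
Lemma straightened_form_unique (f : FP) g g' :
  straightened_form f g -> straightened_form f g' -> g = g'.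
Proof.
have can h : straightened_form f h -> forall t, t \in msupp h -> canO t.
  by case=> hs _ t /hs /straightened7_can.
move=> fg fg'; apply/malgP => m.
have [cm|ncm] := boolP (canO m).
  rewrite -(coordO_class (can _ fg) cm) -(coordO_class (can _ fg') cm).
  by case: fg => _ <-; case: fg' => _ <-.
by rewrite !mcoeff_outdom //; apply: contra ncm; exact: can.
Qed.

Definition malg_of (L : seq (Z * tmon 'I_n)) : {malg rat[tmon 'I_n]} :=
  zsum (fun t => << t >>) L.

Lemma mcoeff_malg_of L m :
  (malg_of L)@_m = \sum_(p <- L | p.2 == m) ratz p.1.
Proof.
rewrite /malg_of /zsum raddf_sum [RHS]big_mkcond; apply: eq_bigr => p _ /=.
rewrite [LHS]mcoeffZ mcoeffU; case: eqP => _; first exact: mulr1.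
exact: mulr0.
Qed.

Definition reduced (L : seq (Z * tmon 'I_n)) : bool :=
  all (fun p => ~~ Z.eqb p.1 Z0) L &&
  pairwise (fun p q : Z * tmon 'I_n => ~~ teq p.2 q.2) L.

Lemma reduced_uniq L : reduced L -> uniq (map snd L).
Proof.
case/andP=> _; rewrite uniq_pairwise pairwise_map; apply: sub_pairwise => p q.
by rewrite teqE.
Qed.

Lemma msupp_malg_of L : reduced L -> perm_eq (msupp (malg_of L)) (map snd L).
Proof.
move=> rL; apply: uniq_perm; rewrite ?fset_uniq ?reduced_uniq // => m.
rewrite -mcoeff_neq0 mcoeff_malg_of -big_filter.
have [mL|nmL] := boolP (m \in map snd L); last first.
  rewrite big1_seq ?eqxx // => p /=; rewrite mem_filter => /andP[/eqP pm pL].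
  by case/negP: nmL; rewrite -pm map_f.
case/mapP: mL => p pL ->.
have -> : [seq q <- L | q.2 == p.2] = [:: p].
  have := reduced_uniq rL; elim: L pL {rL} => //= q L h.
  rewrite inE => /orP[/eqP <-|pL] /andP[qL uL].
    rewrite eqxx; congr (_ :: _); apply/eqP; rewrite -(negbK (_ == _)).
    rewrite -has_filter -all_predC; apply/allP => r rL /=.
    by apply: contra qL => /eqP <-; rewrite map_f.
  by case: eqP => [e|_]; [case/negP: qL; rewrite e map_f | exact: h].
rewrite big_seq1 ratz_eq0.
by case/andP: rL => /allP /(_ _ pL).
Qed.

Lemma number_of_termsP (f : FP) L :
  reduced L -> all (fun p => straightened7 p.2) L ->
  f = 12%:R^-1 *: zsum (tmon_eval (@pata_gen 'I_n)) L ->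
  number_of_terms f (size L).
Proof.
move=> rL sL fE; pose g := 12%:R^-1 *: malg_of L.
have gs : msupp g = msupp (malg_of L) by rewrite msuppZ.
have fg : straightened_form f g.
  split=> [t|].
    rewrite gs (perm_mem (msupp_malg_of rL)) => /mapP[p pL ->].
    exact: (allP sL).
  rewrite fE pata_classZ; congr (_ *: _).
  rewrite /malg_of /zsum (big_morph _ (@pata_classD _) (@pata_class0 _)).
  by apply: eq_bigr => p _; rewrite pata_classZ tmon_eval_gen.
exists g; first by split=> // g' fg'; exact: (straightened_form_unique fg fg').
by rewrite gs (perm_size (msupp_malg_of rL)) size_map.
Qed.

End CoordinateFunctionals.

Local Notation FP5 := (freePATA 'I_5).
Local Notation ev := (tmon_eval (@pata_gen 'I_5)).

(** * Enumeration of the sorted monomials of the component *)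

Fixpoint nodes (X : Type) (t : tmon X) : nat :=
  if t is TMul t1 t2 t3 then (nodes t1 + nodes t2 + nodes t3).+1 else 0%N.

Lemma size_leaves (X : Type) (t : tmon X) : size (leaves t) = (nodes t).*2.+1.
Proof.
by elim: t => //= t1 h1 t2 h2 t3 h3; rewrite !size_cat h1 h2 h3; lia.
Qed.

Lemma canO_shape (t : tmon 'I_5) : canO t -> nodes t = 3 ->
  exists2 i, (i < 5)%N & t = nth (TVar va) (shapes (leaves t)) i.
Proof.
case: t => [//|t1 t2 t3] ct nt.
(* All trees with three products are enumerated; those that are not sorted are then excluded by
   [canO]. *)
repeat match goal with
| t : tmon 'I_5 |- _ => destruct t; simpl in nt; try lia
end.
all: move: ct; rewrite /= ?andbF ?andbT // => _.
all: by [exists 0 | exists 1 | exists 2 | exists 3 | exists 4].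
Qed.

Lemma basis22111P (t : tmon 'I_5) :
  canO t -> perm_eq (leaves t) content -> t \in basis22111.
Proof.
move=> ct lt; have nt : nodes t = 3.
  by have := size_leaves t; rewrite (perm_size lt) /=; lia.
have [i i5 ti] := canO_shape ct nt.
rewrite /basis22111; apply/flatten_mapP; exists i; first by rewrite mem_iota.
rewrite mem_filter ct; apply/mapP; exists (leaves t) => //.
by rewrite mem_permutations.
Qed.

Lemma basis22111_can t : t \in basis22111 -> canO t.
Proof. by case/flatten_mapP=> i _; rewrite mem_filter => /andP[]. Qed.

Lemma basis22111_uniq : uniq basis22111.
Proof.
have /(sub_pairwise (r' := fun s t => s != t)) h :
  pairwise (fun s t : tmon 'I_5 => ~~ teq s t) basis22111 by vm_compute.
by rewrite uniq_pairwise; apply: h => s t; rewrite teqE.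
Qed.

(** * The component of degree 22111 *)

Definition expanded (f : FP5) : Prop :=
  f = \sum_(m <- basis22111) coordO m f *: ev m.

Lemma expandedP c f h : expanded f -> expanded h -> expanded (c *: f + h).
Proof.
move=> ef eh; rewrite /expanded {1}ef {1}eh scaler_sumr -big_split /=.
by apply: eq_bigr => m _; rewrite coordOP scalerDl scalerA.
Qed.

Lemma expanded0 : expanded 0.
Proof.
by rewrite /expanded big1 // => m _; rewrite coordO0 scale0r.
Qed.

Lemma expanded_basis m : m \in basis22111 -> expanded (ev m).
Proof.
move=> mB; rewrite /expanded.
transitivity (\sum_(u <- basis22111) if u == m then ev m else 0).
  rewrite -big_mkcond -big_filter.
  by rewrite filter_pred1_uniq ?basis22111_uniq // big_seq1.
rewrite big_seq [RHS]big_seq; apply: eq_bigr => u uB.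
rewrite coordO_mon ?basis22111_can //; case: eqP => [->|_].
  by rewrite scale1r.
by rewrite scale0r.
Qed.

(** By linearity only monomials matter. Straightening preserves the leaves, so up to sign each one
    becomes a member of [basis22111], unless it vanishes. *)
Lemma V22111_expanded f : V22111 f -> expanded f.
Proof.
case=> g gc ->; rewrite pata_class_expand big_seq.
apply: (big_ind expanded) => [|f1 f2 e1 e2|t /gc lt]; first exact: expanded0.
  by rewrite -[f1]scale1r; exact: expandedP.
rewrite nfO_correct -[_ *: _]addr0.
case e: (nfO t) => [[b u]|] /=; last by rewrite scaler0 addr0; exact: expanded0.
rewrite scalerA; apply: expandedP expanded0.
apply/expanded_basis/basis22111P; first exact: nfO_can e.
exact: perm_trans (nfO_leaves e) lt.
Qed.

Lemma component_lin (s : seq 'I_5) c f h :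
  component s f -> component s h -> component s (c *: f + h).
Proof.
move=> [g gs ->] [k ks ->]; exists (c *: g + k); last first.
  by rewrite pata_class_is_linear.
move=> t /(fsubsetP (msuppD_le _ _)).
rewrite in_fsetU => /orP[|]; last exact: ks.
by move/(fsubsetP (msuppZ_le _ _)); exact: gs.
Qed.

Lemma satisfied_lin c f h : satisfied_by_pats f -> satisfied_by_pats h ->
  satisfied_by_pats (c *: f + h : FP5).
Proof.
by move=> sf sh D v; rewrite pata_eval_is_linear sf sh scaler0 addr0.
Qed.

Lemma N22111_lin c f h : N22111 f -> N22111 h -> N22111 (c *: f + h).
Proof.
move=> [Vf sf] [Vh sh]; split; first exact: component_lin.
exact: satisfied_lin.
Qed.

(** * The two identities *)

(** Extends a function of five letters to lists, so that a sum over the group becomes a sum over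
    [permutations letters5]. The default 0 is never reached there, those lists having length 5. *)
Definition on_letters (W : zmodType)
    (F : 'I_5 -> 'I_5 -> 'I_5 -> 'I_5 -> 'I_5 -> W) (l : seq 'I_5) : W :=
  if l is [:: p; q; r; s; t] then F p q r s t else 0.

Lemma I22111_1_terms : I22111_1 = 12%:R^-1 *: zsum ev terms22111.
Proof.
pose V i := TVar (i : 'I_5); pose G := @pata_gen 'I_5.
pose T1 p q r s t :=
  TMul (TMul (TMul (V va) (V p) (V q)) (V vb) (V r)) (V s) (V t).
pose T2 p q r s t :=
  TMul (TMul (V va) (TMul (V p) (V q) (V r)) (V vb)) (V s) (V t).
pose T3 p q r s t :=
  TMul (TMul (V va) (V p) (V q)) (TMul (V r) (V s) (V t)) (V vb).
pose T4 p q r s t :=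
  TMul (V va) (TMul (TMul (V p) (V q) (V r)) (V vb) (V s)) (V t).
pose S (T : 'I_5 -> 'I_5 -> 'I_5 -> 'I_5 -> 'I_5 -> tmon 'I_5) :=
  \sum_(l <- permutations letters5)
    (-1) ^+ odd_inversions l *:
      on_letters (fun p q r s t => ev (T p q r s t)) l.
have altE (T : 'I_5 -> 'I_5 -> 'I_5 -> 'I_5 -> 'I_5 -> tmon 'I_5) :
    alt_sum (fun s => ev (T (s va) (s vb) (s vc) (s vd) (s ve))) = S T.
  exact: (sum_S5 (fun b l => (-1) ^+ b *: on_letters _ l)).
transitivity (4%:R^-1 *: S T1 - 12%:R^-1 *: S T2 - 12%:R^-1 *: S T3
              - 6%:R^-1 *: S T4).
  congr (_ *: _ - _ *: _ - _ *: _ - _ *: _).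
  - exact: (altE T1).
  - exact: (altE T2).
  - exact: (altE T3).
  - exact: (altE T4).
rewrite /S /zsum /terms22111 {altE S}.
(* The list is abstracted to keep its 120 entries from being unfolded. The comparison is then made
   entry by entry, and lists of a wrong length contribute zero on both sides. *)
move: (permutations letters5) => P.
move: (tmon_eval _) => E.
rewrite big_flatten big_map.
rewrite !scaler_sumr.
rewrite -!sumrB.
apply: eq_bigr => l _; rewrite /on_letters.
case: l => [|p [|q [|r [|s [|t [|u l]]]]]].
1-5,7: by rewrite big_nil !scaler0 !subr0.
rewrite -[X in _ = _ *: X]/(zsum E _) !zsum_cons /zsum big_nil.
case: odd_inversions; rewrite /= addr0 !scalerDr !scalerA -!scaleNr !addrA.
  by congr (_ *: _ + _ *: _ + _ *: _ + _ *: _); apply/eqP.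
by congr (_ *: _ + _ *: _ + _ *: _ + _ *: _); apply/eqP.
Qed.

Lemma I22111_1E : I22111_1 = 12%:R^-1 *: zsum ev form1.
Proof.
rewrite I22111_1_terms /form1; move: terms22111 => L.
by rewrite zsum_straighten.
Qed.

Lemma linear_scale (V W : lmodType rat) (h : V -> W) c x :
  linear h -> h (c *: x) = c *: h x.
Proof.
move=> lh; have h0 : h 0 = 0.
  by have := lh (-1) 0 0; rewrite scaler0 addr0 scaleN1r addNr.
by have := lh c x 0; rewrite h0 !addr0.
Qed.

Lemma linear_zsum (V W : lmodType rat) (h : V -> W) T (F : T -> V) L :
  linear h -> h (zsum F L) = zsum (fun x => h (F x)) L.
Proof.
move=> lh; have hD x y : h (x + y) = h x + h y.
  by have := lh 1 x y; rewrite !scale1r.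
have h0 : h 0 = 0 by rewrite -(scale0r 0) linear_scale // scale0r.
rewrite /zsum (big_morph h hD h0); apply: eq_bigr => p _.
exact: linear_scale.
Qed.

Lemma eq_zsum (W : lmodType rat) T (F G : T -> W) L :
  F =1 G -> zsum F L = zsum G L.
Proof. by move=> FG; apply: eq_bigr => p _; rewrite FG. Qed.

Lemma pata_eval_zsum (P : pataType) (w : 'I_5 -> P) c L :
  pata_eval w (c *: zsum ev L) = c *: zsum (tmon_eval w) L.
Proof.
rewrite (linear_scale _ _ (pata_eval_is_linear w)).
rewrite (linear_zsum _ _ (pata_eval_is_linear w)).
by congr (_ *: _); apply: eq_zsum => t; exact: pata_eval_tmon.
Qed.

Lemma tmon_eval_tmap (P : ternaryType) (w : 'I_5 -> P) f t :
  tmon_eval w (tmap f t) = tmon_eval (w \o f) t.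
Proof. by elim: t => //= t1 -> t2 -> t3 ->. Qed.

Lemma eq_tmon_eval (P : ternaryType) (w w' : 'I_5 -> P) t :
  w =1 w' -> tmon_eval w t = tmon_eval w' t.
Proof.
by move=> e; elim: t => [i|t1 h1 t2 h2 t3 h3] /=; rewrite ?e ?h1 ?h2 ?h3.
Qed.

Lemma swap_abE : swap_ab =1 tperm va vb.
Proof.
move=> i; case: tpermP => [->|->|/eqP ia /eqP ib]; try exact: val_inj.
by apply: val_inj; case: i ia ib => -[|[|[|[|[|]]]]].
Qed.

Lemma I22111_2_terms : I22111_2 =
  12%:R^-1 *: zsum (tmon_eval (@pata_gen 'I_5 \o swap_ab)) terms22111.
Proof.
rewrite /I22111_2 I22111_1_terms; move: terms22111 => L.
rewrite pata_eval_zsum.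
apply: congr1.
apply: eq_zsum => t.
apply: eq_tmon_eval => i /=.
by rewrite swap_abE.
Qed.

Lemma I22111_2E : I22111_2 = 12%:R^-1 *: zsum ev form2.
Proof.
rewrite I22111_2_terms /form2; move: terms22111 => L; apply: congr1.
transitivity (zsum ev [seq (p.1, tmap swap_ab p.2) | p <- L]); last first.
  exact: esym (zsum_straighten _ _).
rewrite [RHS]big_map; apply: eq_bigr => p _; apply: congr1.
exact: esym (tmon_eval_tmap _ _ _).
Qed.

(** * Vanishing of the two identities in every dialgebra *)

Definition zwords (L : seq (Z * tmon 'I_5)) : seq (Z * seq nat) :=
  [seq ((if q.1 then Z.opp p.1 else p.1), key q.2) | p <- L, q <- expO p.2].

(** A left inverse of [key]; with it the value of a word becomes a function of keys, to which
    [cancelsP] applies. *)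
Definition unkey (k : seq nat) : mword 5 :=
  if k is i :: x :: w then
    (take i (map inord w), inord x, drop i (map inord w))
  else ([::], va, [::]).

Arguments unkey : simpl never.

Lemma keyK (m : mword 5) : unkey (key m) = m.
Proof.
case: m => [[l x] r]; rewrite /unkey /= inord_val -map_comp.
rewrite (eq_map (g := id)) => [|i /=]; last exact: inord_val.
by rewrite map_id take_size_cat // drop_size_cat.
Qed.

Lemma zsum_zwords (D : dialgebraType) (v : 'I_5 -> D) L :
  zsum (fun k => mword_eval v (unkey k)) (zwords L) = zsum (pats_eval v) L.
Proof.
rewrite /zsum big_allpairs_dep; apply: eq_bigr => p _.
rewrite expO_correct /ssum scaler_sumr; apply: eq_bigr => q _ /=.
by rewrite keyK scalerA; case: q.1; rewrite ?ratzN ?expr1 ?mulrN1 ?expr0 ?mulr1.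
Qed.

Lemma zwords_form1 : keys_of_size 8 (zwords form1) && cancels 8 (zwords form1).
Proof. by vm_compute. Qed.

Lemma I22111_1_satisfied : satisfied_by_pats I22111_1.
Proof.
move=> D v; rewrite I22111_1E pata_eval_zsum.
rewrite (eq_zsum _ (G := pats_eval (v : _ -> D))); last first.
  by move=> t; exact: tmon_eval_pats.
have /andP[ks cs] := zwords_form1.
by rewrite -zsum_zwords (cancelsP ks cs) scaler0.
Qed.

(** Its value at [v] is the value of the first identity at [v \o swap_ab], so no second cancellation
    is computed. *)
Lemma I22111_2_satisfied : satisfied_by_pats I22111_2.
Proof.
move=> D v; have := I22111_1_satisfied (v \o swap_ab).
rewrite I22111_1_terms I22111_2_terms; move: terms22111 => L.
rewrite pata_eval_zsum => e.
rewrite -[RHS]e (linear_scale _ _ (pata_eval_is_linear v)).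
rewrite (linear_zsum _ _ (pata_eval_is_linear v)).
apply: congr1.
apply: eq_zsum => t; rewrite -tmon_eval_tmap pata_eval_tmon.
by rewrite tmon_eval_tmap.
Qed.

Definition form_ok (L : seq (Z * tmon 'I_5)) : bool :=
  [&& reduced L, all (fun p => straightened7 p.2) L,
      all (fun p => perm_eq (leaves p.2) content) L & eqn (size L) 60].

Lemma form1_ok : form_ok form1. Proof. by vm_compute. Qed.
Lemma form2_ok : form_ok form2. Proof. by vm_compute. Qed.

Section Forms.
Variables (f : FP5) (L : seq (Z * tmon 'I_5)).
Hypotheses (okL : form_ok L) (fE : f = 12%:R^-1 *: zsum ev L).

Lemma form_terms : number_of_terms f 60.
Proof.
by case/and4P: okL => rL sL _ /eqnP <-; exact: number_of_termsP.
Qed.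

Lemma form_class : f = pata_class (12%:R^-1 *: malg_of L).
Proof.
rewrite fE pata_classZ.
apply: congr1.
rewrite /malg_of (linear_zsum _ _ (@pata_class_is_linear 'I_5)).
by apply: eq_zsum => t; exact: tmon_eval_gen.
Qed.

Lemma form_msupp t :
  t \in msupp (12%:R^-1 *: malg_of L) -> exists2 p, p \in L & t = p.2.
Proof.
case/and4P: okL => rL _ _ _; rewrite msuppZ /= (perm_mem (msupp_malg_of rL)).
by case/mapP=> p pL ->; exists p.
Qed.

Lemma form_V22111 : V22111 f.
Proof.
exists (12%:R^-1 *: malg_of L); last exact: form_class.
move=> t /form_msupp[p pL ->].
by case/and4P: okL => _ _ /allP /(_ _ pL).
Qed.

Lemma form_coordO m : canO m ->
  (coordO m f == 0) = ~~ has (fun p => teq m p.2) L.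
Proof.
move=> cm; rewrite form_class coordO_class //; last first.
  move=> t /form_msupp[p pL ->]; apply: straightened7_can.
  by case/and4P: okL => _ /allP /(_ _ pL).
rewrite -(negbK (_ == 0)) mcoeff_neq0; congr (~~ _).
case/and4P: okL => rL _ _ _; rewrite msuppZ /= (perm_mem (msupp_malg_of rL)).
apply/mapP/hasP => -[p pL e]; exists p => //; first by rewrite e teqE.
by move: e; rewrite teqE => /eqP.
Qed.

End Forms.

(** * Elimination and the dimension of the space of identities *)

Lemma system_zero : forces_zero 330 Z0 system22111.
Proof. by vm_compute. Qed.

Lemma size_basis22111 : size basis22111 = 330.
Proof. by vm_compute. Qed.

(* Monomials of I22111_1 but not of I22111_2, and conversely; their coordinates
   are the two additional unknowns put to zero in [system22111]. *)
Definition pivot1 : tmon 'I_5 := nth (TVar va) basis22111 324.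
Definition pivot2 : tmon 'I_5 := nth (TVar va) basis22111 329.

Lemma pivots_ok : [&& canO pivot1, canO pivot2,
  has (fun p => teq pivot1 p.2) form1, ~~ has (fun p => teq pivot2 p.2) form1,
  ~~ has (fun p => teq pivot1 p.2) form2 & has (fun p => teq pivot2 p.2) form2].
Proof. by vm_compute. Qed.

Lemma sign_coef_keyed (L : seq (bool * mword 5)) m :
  sign_coef (keyed L) (key m) = mcount L m.
Proof.
rewrite /sign_coef /mcount /ssum big_map big_mkcond; apply: eq_bigr => p _ /=.
rewrite (inj_eq (can_inj keyK)); case: eqP => _; first exact: esym (mulr1 _).
exact: esym (mulr0 _).
Qed.

(** The expansion of [f] is evaluated in the bimodule dialgebra of a free associative algebra, and
    the coefficient of the centred word is extracted. *)
Lemma word_equation f k : V22111 f -> satisfied_by_pats f ->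
  \sum_(t <- basis22111) coordO t f * sign_coef (keyed (expO t)) k = 0.
Proof.
(* A list that is not the key of any word gives a trivial equation. *)
move=> Vf sf; have [[m <-]|nk] := pselect (exists m : mword 5, key m = k);
  last first.
  apply: big1 => t _; rewrite /sign_coef big1_seq ?mulr0 //.
  move=> p /= /andP[/eqP pk].
  by case/mapP=> q _ e; case: nk; exists q.2; rewrite -pk e.
pose v : 'I_5 -> pats_of (bimod_dialg _) := @word_var 5.
pose coef (x : pats_of (bimod_dialg _)) : rat := x.1@_(FMonom (centred m)).
have coefD : {morph coef : x y / x + y} by move=> x y; exact: mcoeffD.
have coef0 : coef 0 = 0 by exact: mcoeff0.
have : coef (pata_eval v f) = 0 by rewrite sf.
rewrite {1}(V22111_expanded Vf).
have pD : {morph pata_eval v : x y / x + y}.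
  by move=> x y; have := pata_eval_is_linear v 1 x y; rewrite !scale1r.
have p0 : pata_eval v 0 = 0.
  by have := linear_scale 0 0 (pata_eval_is_linear v); rewrite !scale0r.
rewrite (big_morph (pata_eval v) pD p0) (big_morph coef coefD coef0) => e.
rewrite -[RHS]e; apply: eq_bigr => t _.
rewrite (linear_scale _ _ (pata_eval_is_linear v)) pata_eval_tmon.
rewrite [RHS]mcoeffZ; apply: congr1.
by rewrite sign_coef_keyed -pats_eval_coef tmon_eval_pats.
Qed.

Lemma N22111_trivial f : N22111 f ->
  coordO pivot1 f = 0 -> coordO pivot2 f = 0 -> f = 0.
Proof.
move=> [Vf sf] f1 f2.
(* [c] is total on [Z], but only the indices from 0 to 329 concern basis monomials. *)
pose c (i : Z) := coordO (nth (TVar va) basis22111 (Z.to_nat i)) f.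
have c0 := forces_zeroP (c := c) system_zero.
rewrite (V22111_expanded Vf) big_seq big1 // => m mB.
have im : (index m basis22111 < 330)%N.
  by apply: leq_trans (eq_leq size_basis22111); rewrite index_mem.
suff : c (Z.of_nat (index m basis22111)) = 0.
  by rewrite /c Nat2Z.id nth_index // => ->; rewrite scale0r.
apply: c0; last lia.
move=> p; rewrite mem_cat => /orP[|].
  rewrite !inE => /orP[] /eqP ->; rewrite zdot_cons /zdot big_nil addr0.
    by apply/eqP; rewrite mulf_eq0; apply/orP; right; apply/eqP.
  by apply/eqP; rewrite mulf_eq0; apply/orP; right; apply/eqP.
apply: zdot_key_rows => k.
rewrite -[RHS](word_equation k Vf sf).
apply: (@sum_zindex c _ _ (TVar va) basis22111 (fun t => keyed (expO t)) Z0
  (fun t => coordO t f) (fun L => sign_coef L k)) => i _.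
by rewrite /c Z.add_0_l Nat2Z.id.
Qed.

Lemma ord2_cases (i : 'I_2) : i = ord0 \/ i = ord_max.
Proof. by case: i => -[|[|]] // h; [left|right]; exact: val_inj. Qed.

Lemma lincomb_of_sub0 (V : lmodType rat) (a b : rat) (x y z : V) :
  - b *: y + (- a *: x + z) = 0 -> z = a *: x + b *: y.
Proof.
rewrite !scaleNr addrA -opprD => /eqP; rewrite addrC subr_eq0 => /eqP ->.
exact: addrC.
Qed.

Lemma cancel_coord1 (p q r s : rat) :
  q = 0 -> p != 0 -> - s * q + (- (r / p) * p + r) = 0.
Proof. by move=> -> p0; rewrite mulr0 add0r mulNr divfK // addNr. Qed.

Lemma cancel_coord2 (p q r s : rat) :
  q = 0 -> p != 0 -> - (r / p) * p + (- s * q + r) = 0.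
Proof. by move=> -> p0; rewrite mulr0 add0r mulNr divfK // addNr. Qed.

Theorem theorem8p4 :
  is_basis_of N22111 [tuple I22111_1; I22111_2] /\
  number_of_terms I22111_1 60 /\
  number_of_terms I22111_2 60.
Proof.
have /and5P[p1 p2 p11 p21 /andP[p12 p22]] := pivots_ok.
have c1 m cm := form_coordO form1_ok I22111_1E (m := m) cm.
have c2 m cm := form_coordO form2_ok I22111_2E (m := m) cm.
have x11 : coordO pivot1 I22111_1 != 0 by rewrite c1 // negbK.
have x22 : coordO pivot2 I22111_2 != 0 by rewrite c2 // negbK.
have x21 : coordO pivot2 I22111_1 = 0 by apply/eqP; rewrite c1.
have x12 : coordO pivot1 I22111_2 = 0 by apply/eqP; rewrite c2.
have N1 : N22111 I22111_1.
  by split; [exact: form_V22111 form1_ok I22111_1E | exact: I22111_1_satisfied].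
have N2 : N22111 I22111_2.
  by split; [exact: form_V22111 form2_ok I22111_2E | exact: I22111_2_satisfied].
have sumE (c : 'I_2 -> rat) : \sum_i c i *: tnth [tuple I22111_1; I22111_2] i =
    c ord0 *: I22111_1 + c ord_max *: I22111_2.
  rewrite big_ord_recl big_ord_recl big_ord0 addr0.
  by congr (c _ *: _ + c _ *: _); apply: val_inj.
split; last by split; [exact: form_terms form1_ok I22111_1E
                      |exact: form_terms form2_ok I22111_2E].
split=> [f|c]; last first.
  (* Each identity has a nonzero coordinate at its own pivot and zero at the other, so the pivot
     coordinates isolate the two coefficients. *)
  rewrite sumE => e i.
  have := congr1 (coordO pivot1) e.
  rewrite coordOP coordOZ x12 mulr0 addr0 coordO0 => /eqP.
  rewrite mulf_eq0 (negbTE x11) orbF => /eqP i0.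
  have := congr1 (coordO pivot2) e.
  rewrite coordOP coordOZ x21 mulr0 add0r coordO0 => /eqP.
  rewrite mulf_eq0 (negbTE x22) orbF => /eqP i1.
  by case: (ord2_cases i) => ->.
split=> [Nf|[c ->]]; last first.
  have N0 : N22111 0 by have := N22111_lin (-1) N1 N1; rewrite scaleN1r addNr.
  rewrite sumE -[c ord_max *: _]addr0.
  exact: N22111_lin N1 (N22111_lin _ N2 N0).
(* With these coefficients the combination of the two identities agrees with [f] at both pivots. The
   difference is an identity with zero pivot coordinates, hence zero by [N22111_trivial]. *)
pose a := coordO pivot1 f / coordO pivot1 I22111_1.
pose b := coordO pivot2 f / coordO pivot2 I22111_2.
exists (fun i : 'I_2 => if i == ord0 then a else b); rewrite sumE /=.
have Ng : N22111 (- b *: I22111_2 + (- a *: I22111_1 + f)).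
  exact: N22111_lin N2 (N22111_lin _ N1 Nf).
have gE m : coordO m (- b *: I22111_2 + (- a *: I22111_1 + f)) =
    - b * coordO m I22111_2 + (- a * coordO m I22111_1 + coordO m f).
  by rewrite (coordOP m (- b)) (coordOP m (- a)).
apply: lincomb_of_sub0; apply: N22111_trivial Ng _ _; rewrite gE.
  exact: cancel_coord1 x12 x11.
exact: cancel_coord2 x21 x22.
Qed.
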